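(* Let $M$ be a loop- and coloop-free matroid in $\mathrm{CW}(7)$, i.e. such that every antichain in the lattice $\mathcal Z(M)$ of cyclic flats of $M$ has at most $7$ elements. Then $$T_M(2,0)\,T_M(0,2)\ge T_M(1,1)^2 .$$
   Context: All matroids are finite. $T_M(x,y)$ denotes the Tutte polynomial of $M$. A cyclic flat of $M$ is a flat that is a (possibly empty) union of circuits; $\mathcal Z(M)$ is the lattice of cyclic flats of $M$ ordered by inclusion. For a poset $P$, $w(P)$ is the maximum size of an antichain of $P$. For $k\ge 1$, $\mathrm{CW}(k)=\{M: w(\mathcal Z(M))\le k\}$. The multiplicative Merino--Welsh inequality for a loop- and coloop-free matroid $M$ is $T_M(2,0)T_M(0,2)\ge T_M(1,1)^2$. *)

(* Defs.v *)
From mathcomp Require Import all_boot all_order all_algebra.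
Set Implicit Arguments.
Unset Strict Implicit.
Unset Printing Implicit Defensive.
Import Order.TTheory GRing.Theory Num.Theory.
Local Open Scope ring_scope.

(* The ground set of the matroid is the whole finite type [T], which may be
   empty. *)
Record matroid (T : finType) := Matroid {
  indep : {set {set T}};
  indep0 : set0 \in indep;
  indepS : forall A B : {set T}, A \subset B -> B \in indep -> A \in indep;
  indep_aug : forall A B : {set T},
    A \in indep -> B \in indep -> (#|A| < #|B|)%N ->
    exists2 e, e \in B :\: A & e |: A \in indep }.

Section Matroid.
Variables (T : finType) (M : matroid T).

Definition basis (B : {set T}) : bool := maxset (fun A => A \in indep M) B.

Definition circuit (C : {set T}) : bool :=
  minset (fun A => A \notin indep M) C.

Definition loop (e : T) : bool := circuit [set e].

Definition coloop (e : T) : bool :=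
  [forall B : {set T}, basis B ==> (e \in B)].

Definition loopless : Prop := forall e : T, ~~ loop e.
Definition coloopless : Prop := forall e : T, ~~ coloop e.

Definition rank (A : {set T}) : nat :=
  \max_(I in indep M | I \subset A) #|I|.

Definition closure (A : {set T}) : {set T} :=
  [set e | rank (e |: A) == rank A].

Definition flat (F : {set T}) : bool := closure F == F.

(* [S] may be empty, in which case [cover S = set0]. *)
Definition union_of_circuits (A : {set T}) : bool :=
  [exists S : {set {set T}}, [forall C in S, circuit C] && (A == cover S)].

Definition cyclic_flat (F : {set T}) : bool := flat F && union_of_circuits F.

Definition cyclic_flats : {set {set T}} :=
  [set F : {set T} | cyclic_flat F].

(* The corank-nullity expansion; both subtractions on nat are exact, since
   [rank A <= rank setT] and [rank A <= #|A|]. *)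
Definition tutte : {poly {poly int}} :=
  \sum_(A : {set T})
     ('X - 1) ^+ (rank setT - rank A) * ('Y - 1) ^+ (#|A| - rank A).

Definition tutte_eval (x y : int) : int := tutte.[x%:P].[y].

End Matroid.

Section Width.
Variables (P : finType) (le : rel P).

Definition antichain (A : {set P}) : bool :=
  [forall x in A, forall y in A, (x != y) ==> ~~ le x y].

Definition width (S : {set P}) : nat :=
  \max_(A : {set P} | (A \subset S) && antichain A) #|A|.

End Width.

Definition inclusion (T : finType) : rel {set T} := fun A B => A \subset B.

Definition CW (k : nat) (T : finType) (M : matroid T) : bool :=
  (width (@inclusion T) (cyclic_flats M) <= k)%N.

(* Main.v *)
Require Import Defs.
From mathcomp Require Import all_boot all_order all_algebra.
From Stdlib Require BinNat.
From mathcomp Require Import zify ring lra.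
Set Implicit Arguments.
Unset Strict Implicit.
Unset Printing Implicit Defensive.
Import Order.TTheory GRing.Theory Num.Theory.
Local Open Scope ring_scope.

(* Induct on the size of the ground set.  If deleting and contracting e both keep the matroid
   loop- and coloop-free, the inequality follows by Cauchy-Schwarz from the two
   minors, because T(2,0), T(0,2) and T(1,1) are additive.  So in a minimal
   counterexample every element has a parallel or a series partner.  Comparing with
   the deletion of f and the contraction of its parallel class, together with
   T_{M/f}(2,0) <= T_{M\f}(2,0) (and with a factor 2 gained when f lies in a
   triangle), shows that parallel classes have at most two elements and that no
   parallel pair meets a triangle; dually for series pairs.  Hence the matroid is
   made of a parallel pairs and b series pairs.  Five parallel pairs would span ten
   incomparable cyclic flats of rank 2, so a, b <= 4, and representatives of the
   pairs are independent or form a 4-element circuit.  The remaining cases are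
   numerical: deletion-contraction along the series pairs bounds T(2,0) from below
   by 3^b t + (3^b - 2^b) k, with t and k values of T(2,0) on the representatives,
   while the number of bases is at most the number of sets meeting each parallel
   pair at most once and each series pair at least once. *)

(** * Rank functions, minors and duality *)

(** A matroid is handled as a rank function on all subsets of the fixed type [T], together with a
    ground set [X]. Deletion then only shrinks [X], contraction and duality only change the
    function, and no minor needs a type of its own. The width hypothesis bounds the number of pairs
    of each kind by 4 in the final configuration. Everywhere else it only has to survive minors and
    duality, which is why it is restated through ranks of cyclic sets. The numerical end is tight
    for four parallel and four series pairs with independent representatives: the crude count allows
    1921 bases, while the generic lower bound for both [T(2,0)] and [T(0,2)] is 1816. That case
    needs finer information on what contracting one series pair does to the representatives of the
    parallel pairs. *)

Section RankFunctions.
Variable T : finType.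
Implicit Types (A B C D X Y Z : {set T}) (e f g h x y : T) (r : {set T} -> nat).

Definition is_rank r : Prop :=
  [/\ forall A, (r A <= #|A|)%N,
      forall A B, A \subset B -> (r A <= r B)%N &
      forall A B, (r (A :|: B) + r (A :&: B) <= r A + r B)%N].

Definition contract r C : {set T} -> nat := fun A => (r (A :|: C) - r C)%N.

(** Intersecting with [X] makes this a rank function on all subsets of [T], in which the elements
    outside [X] are loops. *)
Definition dual r X : {set T} -> nat :=
  fun A => (#|A :&: X| + r (X :\: A) - r X)%N.

Lemma rank0 r : is_rank r -> r set0 = 0%N.
Proof. by case=> h _ _; apply/eqP; rewrite -leqn0 -(cards0 T). Qed.

Lemma rank_mono r A B : is_rank r -> A \subset B -> (r A <= r B)%N.
Proof. by case=> _ + _; apply. Qed.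

Lemma rank_card r A : is_rank r -> (r A <= #|A|)%N.
Proof. by case. Qed.

Lemma rank1_le r x : is_rank r -> (r [set x] <= 1)%N.
Proof. by move=> hr; rewrite -(cards1 x) rank_card. Qed.

Lemma rankU_le r A B : is_rank r -> (r (A :|: B) <= r A + r B)%N.
Proof. by case=> _ _ /(_ A B); lia. Qed.

Lemma rankU1_le r x A : is_rank r -> (r (x |: A) <= (r A).+1)%N.
Proof. by move=> hr; have := rankU_le [set x] A hr; have := rank1_le x hr; lia. Qed.

Lemma rankU1_ge r x A : is_rank r -> (r A <= r (x |: A))%N.
Proof. by move=> hr; apply: rank_mono => //; apply: subsetUr. Qed.

(** Submodularity as diminishing returns: adding [D] to the larger set gains no more rank than
    adding it to the smaller one. *)
Lemma rankU_mono r A B D : is_rank r -> A \subset B ->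
  (r (D :|: B) + r A <= r B + r (D :|: A))%N.
Proof.
move=> hr sAB; have [_ mono /(_ (D :|: A) B)] := hr.
rewrite -setUA (setUidPr sAB).
have : (r A <= r ((D :|: A) :&: B))%N by apply: mono; rewrite subsetI subsetUr.
lia.
Qed.

Lemma closure_mono r x A B : is_rank r -> A \subset B ->
  r (x |: A) = r A -> r (x |: B) = r B.
Proof.
move=> hr sAB h; have := rankU_mono [set x] hr sAB; have := rankU1_ge x B hr; lia.
Qed.

Lemma closureU r A D : is_rank r -> (forall x, x \in D -> r (x |: A) = r A) ->
  r (A :|: D) = r A.
Proof.
move=> hr; have [n] := ubnP #|D|; elim: n D => // n IH D ltD hD.
have [->|[x xD]] := set_0Vmem D; first by rewrite setU0.
rewrite -(setD1K xD) setUCA.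
rewrite (closure_mono hr (subsetUl A _) (hD x xD)).
apply: IH => [|y /setD1P[_ yD]]; last exact: hD.
by move: ltD; rewrite (cardsD1 x) xD; lia.
Qed.

Lemma contract_is_rank r C : is_rank r -> is_rank (contract r C).
Proof.
move=> hr; rewrite /contract; split=> [A|A B sAB|A B].
- by have := rankU_le A C hr; have := rank_card A hr; lia.
- by have := rank_mono hr (setSU C sAB); lia.
have [_ mono /(_ (A :|: C) (B :|: C))] := hr.
rewrite -setUUl -setUIl.
have := mono C (A :|: C) (subsetUr _ _).
have := mono C (B :|: C) (subsetUr _ _).
have := mono C (A :&: B :|: C) (subsetUr _ _).
have := mono C (A :|: B :|: C) (subsetUr _ _).
lia.
Qed.

Lemma contractE r C A : is_rank r -> (contract r C A + r C)%N = r (A :|: C).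
Proof. by move=> hr; rewrite subnK // rank_mono ?subsetUr. Qed.

Lemma contract_contract r C D A : is_rank r ->
  contract (contract r C) D A = contract r (C :|: D) A.
Proof.
move=> hr; rewrite /contract.
have -> : A :|: D :|: C = A :|: (C :|: D) by rewrite -setUA (setUC D).
have := rank_mono hr (subsetUl C D); rewrite (setUC D).
have : (r (C :|: D) <= r (A :|: (C :|: D)))%N by rewrite rank_mono ?subsetUr.
lia.
Qed.

Lemma contract_loop r e A : is_rank r -> r [set e] = 0%N -> contract r [set e] A = r A.
Proof.
move=> hr h; rewrite /contract h subn0 setUC; apply: (@closure_mono r e set0) => //.
  exact: sub0set.
by rewrite setU0 h rank0.
Qed.

Lemma dual_is_rank r X : is_rank r -> is_rank (dual r X).
Proof.
move=> hr.
(* This makes the truncated subtraction in [dual] exact. *)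
have E A : (r X <= #|A :&: X| + r (X :\: A))%N.
  rewrite -{1}(setID X A) setIC.
  by have := rankU_le (X :&: A) (X :\: A) hr; have := rank_card (X :&: A) hr;
     rewrite (setIC A); lia.
rewrite /dual; split=> [A|A B sAB|A B].
- have : (r (X :\: A) <= r X)%N by rewrite rank_mono ?subsetDl.
  by have := subset_leq_card (subsetIl A X); lia.
- have : (r (X :\: A) <= #|(B :&: X) :\: A| + r (X :\: B))%N.
    apply: leq_trans (_ : (r ((B :&: X) :\: A :|: (X :\: B)) <= _)%N).
      apply: rank_mono => //; apply/subsetP=> x; rewrite !inE.
      by case: (x \in B); case: (x \in X); case: (x \in A).
    by have := rankU_le ((B :&: X) :\: A) (X :\: B) hr;
       have := rank_card ((B :&: X) :\: A) hr; lia.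
  have := cardsID A (B :&: X).
  have -> : B :&: X :&: A = A :&: X.
    by rewrite setIAC; congr (_ :&: _); apply/setIidPr.
  by lia.
have := E A; have := E B; have := E (A :|: B); have := E (A :&: B).
have [_ _ /(_ (X :\: A) (X :\: B))] := hr.
rewrite -setDIr -setDUr.
have := cardsUI (A :&: X) (B :&: X).
rewrite -setIUl.
have -> : A :&: X :&: (B :&: X) = A :&: B :&: X by rewrite setIACA setIid.
lia.
Qed.

Lemma dualE r X A : is_rank r -> A \subset X ->
  (dual r X A + r X)%N = (#|A| + r (X :\: A))%N.
Proof.
move=> hr sAX; rewrite /dual (setIidPl sAX) subnK //.
rewrite -{1}(setID X A) (setIidPr sAX).
by have := rankU_le A (X :\: A) hr; have := rank_card A hr; lia.
Qed.

Lemma dual_dual r X A : is_rank r -> A \subset X -> dual (dual r X) X A = r A.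
Proof.
move=> hr sAX.
have := dualE (dual_is_rank X hr) sAX.
have := dualE hr (subxx X); have := dualE hr (subsetDl X A).
rewrite setDv rank0 // setDDr setDv set0U (setIidPr sAX).
have := cardsID A X; rewrite (setIidPr sAX); lia.
Qed.

Lemma dual_contract r X C A : is_rank r -> C \subset X -> A \subset X :\: C ->
  dual (contract r C) (X :\: C) A = dual r X A.
Proof.
move=> hr sCX sA.
have sAX : A \subset X by apply: subset_trans sA (subsetDl _ _).
have := dualE (contract_is_rank C hr) sA; have := dualE hr sAX.
have := contractE C (X :\: C) hr; have := contractE C (X :\: C :\: A) hr.
have -> : X :\: C :|: C = X by rewrite setUC setDE setUIr setUCr setIT; apply/setUidPr.
have -> : X :\: C :\: A :|: C = X :\: A.
  apply/setP=> x; rewrite !inE; case xC: (x \in C); rewrite ?orbT ?orbF //=.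
  rewrite (subsetP sCX) // andbT; apply/esym/negP=> xA.
  by have := subsetP sA x xA; rewrite !inE xC.
lia.
Qed.

Lemma dual_delete r X C A : is_rank r -> C \subset X -> A \subset X :\: C ->
  dual r (X :\: C) A = contract (dual r X) C A.
Proof.
move=> hr sCX sA.
have sAX : A \subset X by apply: subset_trans sA (subsetDl _ _).
have sACX : A :|: C \subset X by rewrite subUset sAX.
have := dualE hr sACX; have := dualE hr sCX.
have := dualE hr sA; have := contractE C A (dual_is_rank X hr).
have : #|A :|: C| = (#|A| + #|C|)%N.
  rewrite -cardsUI; have -> : A :&: C = set0.
    apply/setP=> x; rewrite !inE; apply/negP=> /andP[xA xC].
    by have := subsetP sA x xA; rewrite !inE xC.
  by rewrite cards0 addn0.
rewrite setDDl (setUC A C); lia.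
Qed.

Definition loopfree r X : Prop := forall e, e \in X -> r [set e] = 1%N.
(** Applied to a subset of the ground set, this says that the subset is a union of circuits: an
    element lies in a circuit inside the subset exactly when it is not a coloop of the
    restriction. *)
Definition coloopfree r X : Prop := forall e, e \in X -> r (X :\ e) = r X.

Lemma dual_loopfree r X : is_rank r -> coloopfree r X -> loopfree (dual r X) X.
Proof.
move=> hr h e eX; have := @dualE r X [set e] hr; rewrite sub1set => /(_ eX).
by rewrite h // cards1; lia.
Qed.

Lemma dual_coloopfree r X : is_rank r -> loopfree r X -> coloopfree (dual r X) X.
Proof.
move=> hr h e eX; have := dualE hr (subsetDl X [set e]); have := dualE hr (subxx X).
rewrite setDv rank0 // setDDr setDv set0U (setIidPr _) ?sub1set // h //.
have := cardsD1 e X; rewrite eX; lia.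
Qed.

End RankFunctions.

(** * Tutte polynomial values and deletion-contraction *)

Section TutteValues.
Variable T : finType.
Implicit Types (A B C D X Y Z : {set T}) (e f g h x y : T) (r : {set T} -> nat).

(* Since [(-1) ^ (#|A| - r A) = (-1) ^ (#|A| + r A)], this is the value at
   [(2, 0)] of the Tutte polynomial of the restriction of [r] to [X]. *)
Definition tutte20 r X : int := \sum_(A : {set T} | A \subset X) (-1) ^+ (#|A| + r A).
Definition tutte02 r X : int := tutte20 (dual r X) X.
Definition nbases r X : nat :=
  \sum_(B : {set T} | B \subset X) ((r B == #|B|) && (r B == r X)).

Lemma sum_subsetU1 (R : nmodType) e X (F : {set T} -> R) : e \notin X ->
  \sum_(A : {set T} | A \subset e |: X) F A =
  \sum_(A : {set T} | A \subset X) F A + \sum_(A : {set T} | A \subset X) F (e |: A).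
Proof.
move=> eX; rewrite (bigID (fun A : {set T} => e \notin A)) /=; congr (_ + _).
  apply: eq_bigl => A; apply/andP/idP => [[sA eA]|sA].
    by apply/subsetP=> x xA; have := subsetP sA x xA; rewrite !inE => /predU1P[xe|//];
       rewrite -xe xA in eA.
  by rewrite (subset_trans sA (subsetUr _ _)) (contra (subsetP sA e) eX).
rewrite (reindex_onto (fun A : {set T} => e |: A) (fun A : {set T} => A :\ e)) /=; last first.
  by move=> A /andP[_]; rewrite negbK => /setD1K.
apply: eq_bigl => A; rewrite setU11 andbT; apply/andP/idP => [[sA /eqP eqA]|sA].
  rewrite -eqA; apply/subsetP=> x; rewrite !inE => /andP[xe /predU1P[xe'|xA]].
    by rewrite xe' eqxx in xe.
  by have := subsetP sA x; rewrite !inE xA orbT (negPf xe) /= => ->.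
split; first by rewrite setUS.
by rewrite setU1K // (contra (subsetP sA e) eX).
Qed.

Lemma eq_tutte20 r r' X : (forall A, A \subset X -> r A = r' A) ->
  tutte20 r X = tutte20 r' X.
Proof. by move=> h; apply: eq_bigr => A sA; rewrite h. Qed.

Lemma eq_nbases r r' X : (forall A, A \subset X -> r A = r' A) ->
  nbases r X = nbases r' X.
Proof. by move=> h; apply: eq_bigr => A sA; rewrite !h. Qed.

Lemma tutte20_set0 r : is_rank r -> tutte20 r set0 = 1.
Proof.
move=> hr; rewrite /tutte20 (big_pred1 set0) => [|A]; last by rewrite subset0.
by rewrite cards0 rank0.
Qed.

(** The terms of [A] and [e |: A] have equal rank and sizes of opposite parity, so they cancel. *)
Lemma tutte20_loop r e X : is_rank r -> e \notin X -> r [set e] = 0%N ->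
  tutte20 r (e |: X) = 0.
Proof.
move=> hr eX re; rewrite /tutte20 sum_subsetU1 // -big_split /=.
apply: big1 => A sA; have eA : e \notin A by apply: contra eX; apply: subsetP.
rewrite (@closure_mono _ r e set0) ?sub0set ?setU0 ?rank0 //.
by rewrite cardsU1 eA addSn exprS mulN1r subrr.
Qed.

Lemma tutte20_loop_in r e X : is_rank r -> e \in X -> r [set e] = 0%N -> tutte20 r X = 0.
Proof. by move=> hr eX h; rewrite -(setD1K eX) tutte20_loop // !inE eqxx. Qed.

Lemma tutte20U1 r e X : is_rank r -> e \notin X -> r [set e] = 1%N ->
  tutte20 r (e |: X) = tutte20 r X + tutte20 (contract r [set e]) X.
Proof.
move=> hr eX re; rewrite /tutte20 sum_subsetU1 //; congr (_ + _).
apply: eq_bigr => A sA; have eA : e \notin A by apply: contra eX; apply: subsetP.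
have := contractE [set e] A hr; rewrite re setUC => <-.
by rewrite cardsU1 eA /= add1n addn1 addSn addnS !exprS mulrA mulrNN !mul1r.
Qed.

Lemma contract_coloop r e X A : is_rank r -> r (e |: X) = (r X).+1 -> A \subset X ->
  contract r [set e] A = r A.
Proof.
move=> hr h sA; have := contractE [set e] A hr; rewrite setUC.
have := rankU_mono [set e] hr sA; have := rankU1_le e A hr; have := rank1_le e hr.
have := rankU_le [set e] X hr; rewrite h; lia.
Qed.

Lemma tutte20_coloop r e X : is_rank r -> e \notin X -> r (e |: X) = (r X).+1 ->
  tutte20 r (e |: X) = 2 * tutte20 r X.
Proof.
move=> hr eX h; rewrite tutte20U1 //; last first.
  by have := rankU_le [set e] X hr; have := rank1_le e hr; rewrite h; lia.
rewrite (@eq_tutte20 (contract r [set e]) r) ?mulr2n ?mulrDl ?mul1r // => A.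
exact: contract_coloop.
Qed.

Lemma tutte20_ge0 r X : is_rank r -> 0 <= tutte20 r X.
Proof.
have [n] := ubnP #|X|; elim: n r X => // n IH r X ltX hr.
have [->|[e eX]] := set_0Vmem X; first by rewrite tutte20_set0.
have ltXe : (#|X :\ e| < n)%N by move: ltX; rewrite (cardsD1 e) eX.
rewrite -(setD1K eX); have eXe : e \notin X :\ e by rewrite !inE eqxx.
have := rank1_le e hr; case re: (r [set e]) => [|[|//]] _; first by rewrite tutte20_loop.
by rewrite tutte20U1 // addr_ge0 // IH //; apply: contract_is_rank.
Qed.

Lemma tutte20_subset r Y X : is_rank r -> loopfree r X -> Y \subset X ->
  tutte20 r Y <= tutte20 r X.
Proof.
move=> hr lf; have [n] := ubnP #|X|; elim: n X lf => // n IH X lf ltX sYX.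
have [->//|neYX] := eqVneq Y X.
have /properP[_ [e eX eY]] : Y \proper X by rewrite properEneq neYX.
have ltXe : (#|X :\ e| < n)%N by move: ltX; rewrite (cardsD1 e) eX.
apply: le_trans (_ : tutte20 r (X :\ e) <= _).
  apply: IH => // [f /setD1P[_] /lf //|].
  by apply/subsetD1P.
rewrite -{2}(setD1K eX) tutte20U1 ?lf ?inE ?eqxx //.
by rewrite lerDl tutte20_ge0 //; apply: contract_is_rank.
Qed.

Lemma tutte20_parallel r e f X : is_rank r -> r [set e] = 1%N -> r [set f] = 1%N ->
  r [set e; f] = 1%N -> e \in X -> f \notin X -> tutte20 r (f |: X) = tutte20 r X.
Proof.
move=> hr re rf ref eX fX; rewrite tutte20U1 //.
rewrite (@tutte20_loop_in (contract r [set f]) e) ?addr0 //.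
  exact: contract_is_rank.
by rewrite /contract ref rf.
Qed.

(** Deletion and contraction of another element [g] commute with the contraction of [e], so both
    sides split along [g] and compare term by term. If [g] becomes a loop, the left side
    vanishes. *)
Lemma tutte20_contract_le r e X : is_rank r ->
  tutte20 (contract r [set e]) X <= tutte20 r X.
Proof.
have [n] := ubnP #|X|; elim: n r X => // n IH r X ltX hr.
have [->|[g gX]] := set_0Vmem X.
  by rewrite !tutte20_set0 //; apply: contract_is_rank.
have hre := contract_is_rank [set e] hr.
have ltXg : (#|X :\ g| < n)%N by move: ltX; rewrite (cardsD1 g) gX.
have gXg : g \notin X :\ g by rewrite !inE eqxx.
have := rank1_le g hre; case reg: (contract r [set e] [set g]) => [|[|//]] _.
  by rewrite (tutte20_loop_in hre gX reg) tutte20_ge0.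
have rg : r [set g] = 1%N.
  have := contractE [set e] [set g] hr; rewrite reg.
  by have := rankU_le [set g] [set e] hr; have := rank1_le g hr; lia.
rewrite -(setD1K gX) !tutte20U1 //; apply: lerD; first exact: IH.
apply: le_trans (IH (contract r [set g]) _ ltXg (contract_is_rank _ hr)).
rewrite le_eqVlt; apply/orP; left; apply/eqP; apply: eq_tutte20 => A _.
by rewrite !contract_contract // setUC.
Qed.

(** Deleting a coloop halves the value, and deleting any other element does not increase it. *)
Lemma tutte20_ge_pow2 r X : is_rank r -> loopfree r X -> 2 ^+ r X <= tutte20 r X.
Proof.
have [n] := ubnP #|X|; elim: n X => // n IH X ltX hr lf.
have [->|[e eX]] := set_0Vmem X; first by rewrite tutte20_set0 // rank0.
have ltXe : (#|X :\ e| < n)%N by move: ltX; rewrite (cardsD1 e) eX.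
have lfe : loopfree r (X :\ e) by move=> f /setD1P[_] /lf.
have := IH _ ltXe hr lfe.
have : e \notin X :\ e by rewrite !inE eqxx.
have := esym (setD1K eX); move: (X :\ e) => Y EX eY.
have := rankU1_le e Y hr; have := rankU1_ge e Y hr; rewrite -EX leq_eqVlt.
case/predU1P=> [<- _ h|lt le h].
  by rewrite EX tutte20U1 ?lf // (le_trans h) // lerDl tutte20_ge0 //; apply: contract_is_rank.
have E : r X = (r Y).+1 by apply/eqP; rewrite eqn_leq le.
by rewrite E EX tutte20_coloop -?EX // exprS ler_pM2l.
Qed.

(** Elements other than [x] and [y] are removed by deletion and contraction, which keeps [e] in the
    closure of [x] and [y]. Two elements remain, independent before the contraction of [e] (value at
    least 4) and parallel after it (value 2). If contracting [e] creates a loop in [X], the left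
    side is 0; this covers [x = y]. *)
Lemma tutte20_contract_triangle r e x y X : is_rank r -> x \in X -> y \in X ->
  r [set e] = 1%N -> r (e |: [set x; y]) = r [set x; y] ->
  2 * tutte20 (contract r [set e]) X <= tutte20 r X.
Proof.
have [n] := ubnP #|X|; elim: n r X => // n IH r X ltX hr xX yX re cl.
have hre := contract_is_rank [set e] hr.
case: (boolP [exists g in X, contract r [set e] [set g] == 0%N]).
  by move=> /exists_inP[g gX /eqP h]; rewrite (tutte20_loop_in hre gX h) mulr0 tutte20_ge0.
move=> /exists_inPn no_loop.
have nl g : g \in X -> contract r [set e] [set g] = 1%N.
  by move=> /no_loop; have := rank1_le g hre; lia.
have r2 g : g \in X -> r [set g; e] = 2%N.
  by move=> /nl h; have := contractE [set e] [set g] hr; rewrite h re.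
have r1 g : g \in X -> r [set g] = 1%N.
  move=> /r2 h; have := rankU_le [set g] [set e] hr; have := rank1_le g hr.
  by rewrite h; lia.
case: (boolP [exists g in X, (g != x) && (g != y)]).
  move=> /exists_inP[g gX /andP[gx gy]].
  have ltXg : (#|X :\ g| < n)%N by move: ltX; rewrite (cardsD1 g) gX.
  have gXg : g \notin X :\ g by rewrite !inE eqxx.
  have hrg := contract_is_rank [set g] hr.
  have xXg : x \in X :\ g by rewrite !inE xX eq_sym gx.
  have yXg : y \in X :\ g by rewrite !inE yX eq_sym gy.
  have rge : contract r [set g] [set e] = 1%N.
    by have := contractE [set g] [set e] hr; rewrite setUC r2 // r1 //; lia.
  rewrite -(setD1K gX) !tutte20U1 ?nl ?r1 // mulrDr; apply: lerD.
    exact: IH.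
  apply: le_trans (IH (contract r [set g]) _ ltXg hrg xXg yXg rge _); last first.
    by rewrite /contract -setUA (closure_mono hr (subsetUl _ _) cl).
  rewrite le_eqVlt; apply/orP; left; apply/eqP; congr (2 * _).
  by apply: eq_tutte20 => A _; rewrite !contract_contract // setUC.
move=> /exists_inPn Xxy.
have EX : X = x |: [set y].
  apply/setP=> g; rewrite !inE; apply/idP/orP => [/Xxy|[/eqP->|/eqP->]//].
  by rewrite negb_and !negbK => /orP.
have sub : [set x; e] \subset e |: [set x; y].
  by apply/subsetP=> z; rewrite !inE => /orP[->|->]; rewrite ?orbT.
have rxy : r [set x; y] = 2%N.
  have := rank_mono hr sub; rewrite cl r2 //.
  by have := rankU_le [set x] [set y] hr; rewrite !r1 //; lia.
have xy : x != y.
  by apply/eqP=> E; move: rxy; rewrite E setUid r1.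
have -> : tutte20 (contract r [set e]) X = 2.
  rewrite EX (@tutte20_parallel _ y) ?nl ?inE //.
    rewrite -[X in tutte20 _ X]setU0 tutte20_coloop ?tutte20_set0 ?inE //.
    by rewrite setU0 rank0 // nl.
  by rewrite /contract setUC (setUC [set y]) cl rxy re.
have := @tutte20_ge_pow2 r X hr r1.
by rewrite EX rxy.
Qed.

End TutteValues.

(** * Deletion-contraction for [T(0,2)] and bases; width under minors and duality *)

Section DeletionContraction.
Variable T : finType.
Implicit Types (A B C D X Y Z : {set T}) (e f g h x y : T) (r : {set T} -> nat).

Lemma tutte20D1 r e X : is_rank r -> e \in X -> r [set e] = 1%N ->
  tutte20 r X = tutte20 r (X :\ e) + tutte20 (contract r [set e]) (X :\ e).
Proof. by move=> hr eX re; rewrite -{1}(setD1K eX) tutte20U1 // !inE eqxx. Qed.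

Lemma tutte20_coloopD1 r e X : is_rank r -> e \in X -> r (X :\ e) != r X ->
  tutte20 r X = 2 * tutte20 r (X :\ e).
Proof.
move=> hr eX ne; rewrite -{1}(setD1K eX) tutte20_coloop ?inE ?eqxx //.
have := rankU1_le e (X :\ e) hr; have := rankU1_ge e (X :\ e) hr.
by rewrite setD1K //; move: ne; lia.
Qed.

Lemma dual_coloop r e X : is_rank r -> e \in X ->
  (dual r X [set e] + r X = (r (X :\ e)).+1)%N.
Proof. by move=> hr eX; rewrite dualE ?sub1set // cards1. Qed.

Lemma tutte02D1 r e X : is_rank r -> e \in X -> r (X :\ e) = r X ->
  tutte02 r X = tutte02 r (X :\ e) + tutte02 (contract r [set e]) (X :\ e).
Proof.
move=> hr eX re; have s1 : [set e] \subset X by rewrite sub1set.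
have hd := dual_is_rank X hr.
rewrite /tutte02 (tutte20D1 hd eX); last by have := dual_coloop hr eX; rewrite re; lia.
rewrite addrC; congr (_ + _); apply: eq_tutte20 => A sA.
  by rewrite dual_delete.
by rewrite dual_contract.
Qed.

Lemma tutte02_coloop r e X : is_rank r -> e \in X -> r (X :\ e) != r X -> tutte02 r X = 0.
Proof.
move=> hr eX re; apply: (tutte20_loop_in (dual_is_rank X hr) eX).
have := dual_coloop hr eX; have := rank_mono hr (subsetDl X [set e]).
by move: re; lia.
Qed.

Lemma tutte02_loop r e X : is_rank r -> e \in X -> r [set e] = 0%N ->
  tutte02 r X = 2 * tutte02 r (X :\ e).
Proof.
move=> hr eX re; have s1 : [set e] \subset X by rewrite sub1set.
have hd := dual_is_rank X hr.
rewrite /tutte02 (tutte20_coloopD1 hd eX).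
  congr (2 * _); apply: eq_tutte20 => A sA.
  rewrite -(dual_contract hr s1 sA) /dual !contract_loop //.
have := dualE hr (subsetDl X [set e]); have := dualE hr (subxx X).
rewrite setDv rank0 // setDDr setDv set0U (setIidPr s1) re (cardsD1 e X) eX; lia.
Qed.

Lemma tutte02_dual r X : is_rank r -> tutte02 (dual r X) X = tutte20 r X.
Proof. by move=> hr; apply: eq_tutte20 => A; apply: dual_dual. Qed.

Lemma nbasesU1 r e X : is_rank r -> e \notin X -> r [set e] = 1%N ->
  r (e |: X) = r X ->
  nbases r (e |: X) = (nbases r X + nbases (contract r [set e]) X)%N.
Proof.
move=> hr eX re reX; rewrite /nbases sum_subsetU1 //; congr (_ + _)%N.
  by apply: eq_bigr => A sA; rewrite reX.
apply: eq_bigr => A sA; have eA : e \notin A by apply: contra eX; apply: subsetP.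
have := contractE [set e] A hr; have := contractE [set e] X hr.
rewrite re !(setUC _ [set e]) => <- <-.
by rewrite cardsU1 eA /= add1n addn1 addn1 !eqSS.
Qed.

Lemma nbasesD1 r e X : is_rank r -> e \in X -> r [set e] = 1%N -> r (X :\ e) = r X ->
  nbases r X = (nbases r (X :\ e) + nbases (contract r [set e]) (X :\ e))%N.
Proof.
by move=> hr eX re reX; rewrite -{1}(setD1K eX) nbasesU1 ?setD1K ?inE ?eqxx.
Qed.

Lemma nbases_loop r e X : is_rank r -> e \in X -> r [set e] = 0%N ->
  nbases r X = nbases r (X :\ e).
Proof.
move=> hr eX re; rewrite -{1}(setD1K eX) /nbases sum_subsetU1 ?inE ?eqxx //=.
have cl A : r (e |: A) = r A.
  by apply: (@closure_mono _ r e set0); rewrite ?sub0set ?setU0 ?rank0.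
rewrite [X in (_ + X)%R]big1 ?addr0 => [|A /subsetD1P[_ eA]].
  by apply: eq_bigr => A _; rewrite cl.
apply/eqP; rewrite eqb0 cardsU1 eA cl; have := rank_card A hr.
by case: eqP => //= ->; rewrite ltnn.
Qed.

Lemma nbases_coloop r e X : is_rank r -> e \in X -> r (X :\ e) != r X ->
  nbases r X = nbases r (X :\ e).
Proof.
move=> hr eX re; rewrite -{1}(setD1K eX) /nbases sum_subsetU1 ?inE ?eqxx //=.
have E : r X = (r (X :\ e)).+1.
  have := rankU1_le e (X :\ e) hr; have := rankU1_ge e (X :\ e) hr.
  by rewrite setD1K //; move: re; lia.
rewrite setD1K // [X in (X + _)%R]big1 ?add0r => [|A sA].
  apply: eq_bigr => A sA; have /subsetD1P[_ eA] := sA.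
  have := @contract_coloop _ r e (X :\ e) A hr; rewrite (setD1K eX) => /(_ E sA).
  have := contractE [set e] A hr; have := rank_card A hr.
  have := rank1_le e hr; have := rankU_mono [set e] hr sA.
  by rewrite (setD1K eX) (setUC A) cardsU1 eA E /=; lia.
by apply/eqP; rewrite eqb0; have := rank_mono hr sA; rewrite E; lia.
Qed.

(** Complementation in [X] exchanges the bases of a matroid and of its dual. *)
Lemma nbases_dual r X : is_rank r -> nbases (dual r X) X = nbases r X.
Proof.
move=> hr; rewrite /nbases.
rewrite (reindex_onto (fun A => X :\: A) (fun A => X :\: A)) /=; last first.
  by move=> A sA; rewrite setDDr setDv set0U (setIidPr sA).
apply: eq_big => A.
  rewrite subsetDl /= setDDr setDv set0U; apply/eqP/idP => [<-|/setIidPr//].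
  exact: subsetIl.
rewrite subsetDl /= setDDr setDv set0U => /eqP/setIidPr sA.
have := dualE hr (subsetDl X A); have := dualE hr (subxx X).
rewrite setDv rank0 // setDDr setDv set0U (setIidPr sA).
have := cardsID A X; rewrite (setIidPr sA).
have := rank_mono hr sA; have := rank_card A hr.
move=> h1 h2 h3 h4 h5; congr nat_of_bool; apply/andP/andP; lia.
Qed.

Definition merino_welsh r X : bool :=
  (nbases r X)%:Z ^+ 2 <= tutte20 r X * tutte02 r X.

Lemma merino_welsh_dual r X : is_rank r -> merino_welsh (dual r X) X -> merino_welsh r X.
Proof. by move=> hr; rewrite /merino_welsh nbases_dual // tutte02_dual // mulrC. Qed.

(* Closures of cyclic sets are the cyclic flats, so this says that no eight cyclic
   flats form an antichain; with cyclic sets, passing to a deletion is immediate. *)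
Definition cyclic_width_lt8 r X : Prop := forall F : 'I_8 -> {set T},
  (forall i, F i \subset X /\ coloopfree r (F i)) ->
  exists i j : 'I_8, i != j /\ r (F i :|: F j) = r (F j).

Lemma width_delete r X Y : Y \subset X -> cyclic_width_lt8 r X -> cyclic_width_lt8 r Y.
Proof.
move=> sYX w F hF; apply: w => i; have [sF cF] := hF i; split=> //.
exact: subset_trans sYX.
Qed.

(** A cyclic set of the contraction is lifted by adding [e] exactly when [e] is already in its
    closure. The lift [G] is cyclic before contraction, and it agrees with the original set once [e]
    is added, so a containment of closures passes back to the contraction. *)
Lemma width_contract r e X : is_rank r -> e \in X -> cyclic_width_lt8 r X ->
  cyclic_width_lt8 (contract r [set e]) (X :\ e).
Proof.
move=> hr eX w F hF.
pose G i := if r (e |: F i) == r (F i) then e |: F i else F i.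
have [|i [j [ij rij]]] := w G.
  move=> i; have [sF cF] := hF i; have /subsetD1P[sFX eF] := sF.
  rewrite /G; case: eqP => cl; split=> //.
  - by rewrite subUset sub1set eX.
  - move=> f; rewrite !inE => /predU1P[->|fF]; first by rewrite setU1K.
    have ef : e != f by apply: contraNneq eF => ->.
    have -> : (e |: F i) :\ f = e |: F i :\ f.
      by apply/setP=> x; rewrite !inE; case: (eqVneq x e) => [->|]; rewrite ?ef.
    have := cF f fF; have := contractE [set e] (F i) hr.
    by have := contractE [set e] (F i :\ f) hr; rewrite !(setUC _ [set e]); lia.
  move=> f fF; have := cF f fF; have := contractE [set e] (F i) hr.
  have := contractE [set e] (F i :\ f) hr; rewrite !(setUC _ [set e]).
  have := rankU1_le e (F i) hr; have := rankU1_ge e (F i) hr.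
  have := rankU1_le e (F i :\ f) hr; have := rank_mono hr (subsetDl (F i) [set f]).
  by move: cl; lia.
exists i, j; split=> //.
have sG k : F k \subset G k by rewrite /G; case: ifP; rewrite ?subsetUr.
have sG' k : G k \subset e |: F k by rewrite /G; case: ifP; rewrite ?subsetUr.
have rj : r (e |: G j) = r (e |: F j).
  congr r; apply/eqP; rewrite eqEsubset; apply/andP; split; last exact: setUS.
  by rewrite subUset subsetUl sG'.
have sub : e |: (F i :|: F j) \subset (e |: G j) :|: (G i :|: G j).
  apply/subsetP=> x; rewrite !inE => /or3P[->//|/(subsetP (sG i))->|/(subsetP (sG j))->].
    by rewrite !orbT.
  by rewrite !orbT.
have cl : r ((e |: G j) :|: (G i :|: G j)) = r (e |: G j).
  apply: closureU => // x xG; apply: (@closure_mono _ r x (G j) _ hr).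
    exact: subsetUr.
  apply/eqP; rewrite eqn_leq rankU1_ge // andbT -rij.
  by apply: rank_mono; rewrite // subUset sub1set subsetUr andbT.
rewrite /contract !(setUC _ [set e]); congr (_ - _)%N; apply/eqP.
rewrite eqn_leq -rj -[X in (_ <= X)%N && _]cl rank_mono //= rj.
by rewrite rank_mono // setUS // subsetUr.
Qed.

(** Complements of flats of the dual are cyclic sets of the matroid, so each [F i] is replaced by
    the complement of its dual closure [G i]. Complementing reverses the order, hence the exchanged
    indices. If some [x] were in [G j] but not in [G i], it would not be a coloop of [G j] in the
    dual, so adding it to [X :\: G j] would raise the rank, although [X :\: G i] contains it and is
    spanned by [X :\: G j]. *)
Lemma width_dual r X : is_rank r -> cyclic_width_lt8 r X -> cyclic_width_lt8 (dual r X) X.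
Proof.
move=> hr w F hF; have hd := dual_is_rank X hr.
pose d := dual r X; pose G i := [set x in X | d (x |: F i) == d (F i)].
have sFG i : F i \subset G i.
  apply/subsetP=> x xF; rewrite inE (subsetP (hF i).1) //=; apply/eqP; congr d.
  by apply/setUidPr; rewrite sub1set.
have sGX i : G i \subset X by apply/subsetP=> x; rewrite inE => /andP[].
have dG i : d (G i) = d (F i).
  rewrite -(setUidPr (sFG i)); apply: closureU => // x; rewrite inE => /andP[_ /eqP//].
have XDD A x : X :\: (x |: A) = (X :\: A) :\ x by rewrite setDDl setUC.
have [|i [j [ij rij]]] := w (fun i => X :\: G i).
  move=> i; split; first exact: subsetDl.
  move=> f; rewrite inE => /andP[fG fX].
  have := dualE hr (sGX i); have := @dualE _ r X (f |: G i) hr.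
  rewrite subUset sub1set fX sGX XDD cardsU1 fG => /(_ isT).
  have : (d (G i) < d (f |: G i))%N.
    rewrite dG; have := rank_mono hd (setUS [set f] (sFG i)); apply: leq_trans.
    by move: fG; rewrite inE fX /= -/d; have := rankU1_ge f (F i) hd; rewrite -/d; lia.
  have := rank_mono hr (subsetDl (X :\: G i) [set f]).
  by rewrite /d; lia.
exists j, i; rewrite eq_sym; split=> //; rewrite -/d.
suff sG : G j \subset G i.
  apply/eqP; rewrite eqn_leq [X in _ && X]rank_mono ?subsetUr // andbT -(dG i).
  by apply: rank_mono => //; rewrite subUset sFG (subset_trans (sFG j)).
apply/subsetP=> x xG; apply: contraT => xGi.
have xX := subsetP (sGX j) x xG.
have dx : d (G j :\ x) = d (G j).
  apply/eqP; rewrite eqn_leq rank_mono ?subsetDl //= dG.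
  have [xF|xF] := boolP (x \in F j).
    by rewrite -[d (F j)]((hF j).2 x xF); apply: rank_mono => //; apply: setSD.
  by apply: rank_mono => //; apply/subsetD1P.
have := dualE hr (sGX j); have := @dualE _ r X (G j :\ x) hr.
rewrite (subset_trans (subsetDl _ _)) // -/d dx (cardsD1 x (G j)) xG => /(_ isT).
have -> : X :\: (G j :\ x) = x |: (X :\: G j).
  rewrite setDDr setUC; congr (_ :|: _); apply/setIidPr; by rewrite sub1set.
have : (r (x |: (X :\: G j)) <= r (X :\: G j))%N.
  by rewrite -rij; apply: rank_mono => //; apply: setSU; rewrite sub1set inE xGi.
lia.
Qed.

End DeletionContraction.

(** * Minimal counterexamples *)

Section Reduction.
Variable T : finType.
Implicit Types (A B C D X Y Z : {set T}) (e f g h x y : T) (r : {set T} -> nat).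

Lemma cauchy_schwarz (x1 x2 y1 y2 q1 q2 : int) :
  0 <= x1 -> 0 <= x2 -> 0 <= y1 -> 0 <= y2 -> 0 <= q1 -> 0 <= q2 ->
  q1 ^+ 2 <= x1 * y1 -> q2 ^+ 2 <= x2 * y2 ->
  (q1 + q2) ^+ 2 <= (x1 + x2) * (y1 + y2).
Proof.
move=> x1p x2p y1p y2p q1p q2p h1 h2.
(* The square of [q1 * q2] is at most the product of the two terms on the right, so the
   arithmetic-geometric mean inequality applies. *)
suff : 2 * (q1 * q2) <= x1 * y2 + x2 * y1 by nra.
have p1 : 0 <= x1 * y2 by rewrite mulr_ge0.
have p2 : 0 <= x2 * y1 by rewrite mulr_ge0.
rewrite -(@ler_pXn2r _ 2) ?nnegrE ?addr_ge0 ?mulr_ge0 //.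
have : (q1 * q2) ^+ 2 <= (x1 * y2) * (x2 * y1).
  have -> : x1 * y2 * (x2 * y1) = (x1 * y1) * (x2 * y2) by ring.
  by rewrite exprMn ler_pM ?sqr_ge0.
move: (x1 * y2) (x2 * y1) (q1 * q2) => u v w h; have := sqr_ge0 (u - v).
by rewrite sqrrB !expr2 in h *; lia.
Qed.

(** Here [x] is [T(2,0)] of the matroid and of the deletion of [f]; [y], [q] are [T(0,2)] and the
    number of bases of the deletion; [w], [b] are those of the contraction of [f]. After the
    resulting loops are removed the contraction has values [b1], [b2], and the loops contribute the
    factor [c]. *)
Lemma doubling_inequality (x y w q b b1 b2 c k : int) :
  0 <= x -> 0 <= y -> 0 <= q -> 0 <= b -> 0 <= b1 -> 0 <= b2 -> 0 <= c -> 0 <= k ->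
  6 <= k * c -> w = c * b2 -> k * b1 <= x -> y <= w ->
  b ^+ 2 <= b1 * b2 -> q ^+ 2 <= x * y ->
  (q + b) ^+ 2 <= x * (y + w).
Proof.
move=> xp yp qp bp b1p b2p cp kp kc ew kx yw hb hq.
have hw : 6 * b ^+ 2 <= x * w.
  apply: le_trans (_ : (k * b1) * w <= _); last by rewrite ler_wpM2r // (le_trans yp).
  rewrite ew; have -> : k * b1 * (c * b2) = (k * c) * (b1 * b2) by ring.
  by rewrite ler_pM // sqr_ge0.
have hy : x * y <= x * w by rewrite ler_wpM2l.
rewrite mulrDr.
(* The ratio 5/2 lies just above [1 + sqrt 2]. Below it [2 * q * b + b ^+ 2] is at most
   [6 * b ^+ 2], which is the origin of the 6; above it the same expression is at most [q ^+ 2], and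
   [q ^+ 2 <= x * y <= x * w]. *)
have [le|/ltW lt] := leP (2 * q) (5 * b).
  have := ler_wpM2r bp le; nra.
have h1 := ler_wpM2r qp lt; have h2 := ler_wpM2r bp lt; nra.
Qed.

Definition merino_welsh_below X : Prop := forall r Y, (#|Y| < #|X|)%N ->
  is_rank r -> loopfree r Y -> coloopfree r Y -> cyclic_width_lt8 r Y -> merino_welsh r Y.

Lemma contract_coloopfree r e X : is_rank r -> e \in X -> coloopfree r X ->
  coloopfree (contract r [set e]) (X :\ e).
Proof.
move=> hr eX h f; rewrite !inE => /andP[fe fX].
have := contractE [set e] (X :\ e) hr; have := contractE [set e] (X :\ e :\ f) hr.
rewrite !(setUC _ [set e]) setD1K //.
have -> : e |: X :\ e :\ f = X :\ f.
  by apply/setP=> x; rewrite !inE; case: (eqVneq x e) => [->|]; rewrite // eX eq_sym fe.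
by rewrite h //; lia.
Qed.

Lemma merino_welsh_split r e X : is_rank r -> loopfree r X -> coloopfree r X ->
  cyclic_width_lt8 r X -> merino_welsh_below X -> e \in X ->
  coloopfree r (X :\ e) -> loopfree (contract r [set e]) (X :\ e) -> merino_welsh r X.
Proof.
move=> hr lf cf w IH eX cfd lfc.
have ltX : (#|X :\ e| < #|X|)%N by rewrite [X in (_ < X)%N](cardsD1 e) eX.
have hre := contract_is_rank [set e] hr.
have mwd : merino_welsh r (X :\ e).
  apply: IH => //; first by move=> f /setD1P[_] /lf.
  by apply: width_delete w; apply: subsetDl.
have mwc : merino_welsh (contract r [set e]) (X :\ e).
  apply: IH => //; first exact: contract_coloopfree.
  exact: width_contract.
rewrite /merino_welsh (tutte20D1 hr eX) ?lf // (tutte02D1 hr eX) ?cf //.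
rewrite (nbasesD1 hr eX) ?lf ?cf // PoszD.
by apply: cauchy_schwarz; rewrite ?tutte20_ge0 //; apply: dual_is_rank.
Qed.

Definition no_digon r X : Prop := forall e f, e \in X -> f \in X -> e != f ->
  r [set e; f] = 1%N -> r (X :\ e :\ f) = r X.

(** A parallel pair whose deletion lowers the rank is a connected component with Tutte polynomial
    [x + y]. It doubles [T(2,0)], [T(0,2)] and the number of bases, so the inequality lifts from its
    complement. *)
Lemma digon_or r X : is_rank r -> loopfree r X -> coloopfree r X ->
  cyclic_width_lt8 r X -> merino_welsh_below X -> ~~ merino_welsh r X -> no_digon r X.
Proof.
move=> hr lf cf w IH nMW e f eX fX ef ref; apply/eqP; apply: contraT => ne.
case/negP: nMW.
have fXe : f \in X :\ e by rewrite !inE eq_sym ef.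
have eXf : e \in X :\ f by rewrite !inE ef.
have XC : X :\ f :\ e = X :\ e :\ f by rewrite !setDDl setUC.
set Z := X :\ e :\ f in ne XC *.
have ltX : (#|Z| < #|X|)%N.
  by rewrite (cardsD1 e X) eX (cardsD1 f (X :\ e)) fXe /Z; lia.
have [re rf] := (lf e eX, lf f fX).
have hrf := contract_is_rank [set f] hr; have hre := contract_is_rank [set e] hr.
have cle A : e \notin A -> f \notin A -> r (e |: (f |: A)) = r (f |: A).
  move=> _ _; apply: (@closure_mono _ r e [set f]); rewrite ?subsetUl //.
  by rewrite ref rf.
have clf A : r (f |: (e |: A)) = r (e |: A).
  apply: (@closure_mono _ r f [set e]); rewrite ?subsetUl //.
  by rewrite setUC ref re.
have rZf : r (f |: Z) = r X by rewrite /Z setD1K // cf.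
have rZe : r (e |: Z) = r X by rewrite -XC setD1K // cf.
have rZ : r X = (r Z).+1.
  have := rankU1_le e Z hr; have := rankU1_ge e Z hr; rewrite rZe.
  by move: ne; lia.
have cf_f A : A \subset Z -> contract r [set f] A = r A.
  by apply: contract_coloop; rewrite // rZf rZ.
have reK : contract r [set f] [set e] = 0%N by rewrite /contract ref rf.
have mw : merino_welsh r Z.
  apply: IH => //.
  - by move=> h /setD1P[_ /setD1P[_]] /lf.
  - move=> h hZ; have hX : h \in X by move: hZ; rewrite !inE => /and3P[].
    have h1 := cf h hX; have hh := rankU1_ge h (Z :\ h) hr; rewrite setD1K // in hh.
    have : (r X <= r (e |: (f |: (Z :\ h))))%N.
      rewrite -h1; apply: rank_mono => //; apply/subsetP=> x; rewrite !inE.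
      by case: (x == e) (x == f) (x == h) (x \in X) => [] [] [] [].
    rewrite cle ?inE ?eqxx ?andbF //; have := rankU1_le f (Z :\ h) hr; lia.
  - by apply: width_delete w; rewrite /Z setDDl subsetDl.
rewrite /merino_welsh (nbasesD1 hr fX rf (cf f fX)) (tutte02D1 hr fX (cf f fX)).
rewrite (tutte20D1 hr fX rf) (tutte20_loop_in hrf eXf reK) addr0.
have neq : r (X :\ f :\ e) != r (X :\ f) by rewrite XC cf.
rewrite (tutte20_coloopD1 hr eXf neq) (tutte02_coloop hr eXf neq) add0r.
rewrite (nbases_coloop hr eXf neq) (nbases_loop hrf eXf reK) (tutte02_loop hrf eXf reK) XC.
rewrite (eq_nbases cf_f) addnn -muln2 PoszM exprMn.
have -> : tutte02 (contract r [set f]) Z = tutte02 r Z.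
  apply: eq_tutte20 => A sA; rewrite /dual !cf_f ?subsetDl //.
move: mw; rewrite /merino_welsh; move: (tutte20 r Z) (tutte02 r Z) => a b h; lra.
Qed.

Lemma remove_loops r X (L : {set T}) : is_rank r -> L \subset X -> (forall e, e \in L -> r [set e] = 0%N) ->
  tutte02 r X = 2 ^+ #|L| * tutte02 r (X :\: L) /\ nbases r X = nbases r (X :\: L).
Proof.
move=> hr; have [n] := ubnP #|L|; elim: n L X => // n IH L X ltL sL loops.
have [->|[e eL]] := set_0Vmem L; first by rewrite setD0 cards0 mul1r.
have eX := subsetP sL e eL.
have [|||h1 h2] := IH (L :\ e) (X :\ e).
- by move: ltL; rewrite (cardsD1 e) eL.
- exact: setSD.
- by move=> x /setD1P[_] /loops.
rewrite (tutte02_loop hr eX) ?loops // (nbases_loop hr eX) ?loops // h1 h2 setDDl setD1K //.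
by rewrite (cardsD1 e L) eL exprS mulrA.
Qed.

(** Contracting [f] turns the rest of its parallel class into loops, and each of them doubles
    [T(0,2)]. The number [k] is the gain in [T(2,0)] over the contraction; together with these
    doublings it must reach the 6 of [doubling_inequality]. *)
Lemma parallel_class_bound r f X (k : nat) :
  let C := [set h in X | r [set f; h] == 1%N] in
  is_rank r -> loopfree r X -> coloopfree r X ->
  cyclic_width_lt8 r X -> merino_welsh_below X -> f \in X -> coloopfree r (X :\ f) ->
  (1 < #|C|)%N -> (6 <= k * 2 ^ #|C|.-1)%N ->
  k%:Z * tutte20 (contract r [set f]) (X :\: C) <= tutte20 r X -> merino_welsh r X.
Proof.
move=> C hr lf cf w IH fX cfd C1 Ck kX.
have rf := lf f fX; have hrf := contract_is_rank [set f] hr.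
have fC : f \in C by rewrite inE fX setUid rf.
have ltX : (#|X :\ f| < #|X|)%N by rewrite [X in (_ < X)%N](cardsD1 f) fX.
have [h hC hf] : exists2 h, h \in C & h != f.
  have : (0 < #|C :\ f|)%N by move: C1; rewrite (cardsD1 f) fC.
  by move=> /card_gt0P[h /setD1P[hf hC]]; exists h.
have [hX rfh] : h \in X /\ r [set f; h] = 1%N by move: hC; rewrite inE => /andP[-> /eqP].
have CDX : C :\ f \subset X :\ f by apply: setSD; apply/subsetP=> x; rewrite inE => /andP[].
have loopC e : e \in C :\ f -> contract r [set f] [set e] = 0%N.
  by rewrite !inE => /and3P[_ _ /eqP h1]; rewrite /contract setUC h1 rf.
have [t02 nb] := remove_loops hrf CDX loopC.
have XC : X :\ f :\: (C :\ f) = X :\: C by rewrite setDDl setD1K.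
rewrite XC in t02 nb.
have mwd : merino_welsh r (X :\ f).
  apply: IH => //; first by move=> x /setD1P[_] /lf.
  by apply: width_delete w; apply: subsetDl.
have mwc : merino_welsh (contract r [set f]) (X :\: C).
  have sC : C :\ f \subset X :\ f by [].
  have cfc := contract_coloopfree hr fX cf.
  have rk0 A : contract r [set f] (A :|: (C :\ f)) = contract r [set f] A.
    apply: closureU => // x xC; apply: (@closure_mono _ _ x set0) => //.
      exact: sub0set.
    by rewrite setU0 loopC // rank0.
  have rkX : contract r [set f] (X :\: C) = contract r [set f] (X :\ f).
    rewrite -(rk0 (X :\: C)) -XC; congr (contract _ _ _); apply/setP=> z.
    rewrite in_setU in_setD; case: (boolP (z \in C :\ f)) => [zC|_]; last by rewrite orbF.
    by rewrite (subsetP CDX).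
  apply: IH => //.
  - apply: leq_ltn_trans ltX; rewrite -XC subset_leq_card //; exact: subsetDl.
  - move=> x; rewrite inE => /andP[xC xX].
    have := contractE [set f] [set x] hr; rewrite rf setUC.
    have := rank1_le x hrf; have : r [set f; x] != 1%N by move: xC; rewrite inE xX.
    have : (r [set f] <= r [set f; x])%N by rewrite rank_mono ?subsetUl.
    by rewrite rf; lia.
  - move=> x xXC; have /setDP[xX xC] := xXC.
    have xXf : x \in X :\ f by rewrite !inE xX (contraNneq _ xC) // => ->.
    rewrite rkX -(cfc x xXf) -(rk0 (_ :\ x)); congr (contract _ _ _).
    apply/setP=> z; rewrite !inE; case: (eqVneq z x) => [->|_] /=.
      by move: xC; rewrite inE xX /= => /negPf ->; rewrite andbF.
    case: (eqVneq z f) => [->|_] /=; first by rewrite fX setUid rf.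
    by case: (z \in X); case: (r [set f; z] == 1%N).
  - apply: (@width_delete _ _ (X :\ f)); last exact: width_contract.
    by rewrite -XC subsetDl.
have hXf : h \in X :\ f by rewrite !inE hf.
rewrite /merino_welsh (nbasesD1 hr fX rf (cf f fX)) (tutte02D1 hr fX (cf f fX)).
have e20 : tutte20 r X = tutte20 r (X :\ f).
  rewrite (tutte20D1 hr fX rf) (tutte20_loop_in hrf hXf) ?addr0 //.
  by rewrite /contract setUC rfh rf.
have le02 : tutte02 r (X :\ f) <= tutte02 (contract r [set f]) (X :\ f).
  have s1 : [set f] \subset X by rewrite sub1set.
  have := tutte20_contract_le f (X :\ f) (dual_is_rank X hr).
  rewrite /tutte02 (@eq_tutte20 _ (dual r (X :\ f)) (contract (dual r X) [set f])) => [|A sA].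
    by rewrite (@eq_tutte20 _ (dual (contract _ _) _) (dual r X)) // => A sA; rewrite dual_contract.
  by rewrite dual_delete.
rewrite PoszD nb.
apply: (@doubling_inequality _ _ _ _ _ (tutte20 (contract r [set f]) (X :\: C))
  (tutte02 (contract r [set f]) (X :\: C)) (2 ^+ #|C :\ f|) k%:Z);
  rewrite ?tutte20_ge0 ?exprn_ge0 //; try exact: dual_is_rank.
  have -> : #|C :\ f| = #|C|.-1 by rewrite (cardsD1 f C) fC.
  by move: Ck; rewrite -(ler_nat int) natrM natrX (natz k).
by move: mwd; rewrite /merino_welsh e20.
Qed.

(** The case [x = y] excludes a third parallel element, and [x != y] excludes a triangle through
    [e]. *)
Definition thin r X : Prop := forall e f x y, e \in X -> f \in X -> e != f ->
  r [set e; f] = 1%N -> x \in X :\ e :\ f -> y \in X :\ e :\ f ->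
  r (e |: [set x; y]) != r [set x; y].

Lemma minimal_thin r X : is_rank r -> loopfree r X -> coloopfree r X ->
  cyclic_width_lt8 r X -> merino_welsh_below X -> ~~ merino_welsh r X -> thin r X.
Proof.
move=> hr lf cf w IH nMW e f x y eX fX ef ref xZ yZ; apply: contraT => /negPn /eqP cl.
have nd := digon_or hr lf cf w IH nMW.
case/negP: nMW.
have hre := contract_is_rank [set e] hr.
have re := lf e eX.
pose C := [set h in X | r [set e; h] == 1%N].
have eC : e \in C by rewrite inE eX setUid re.
have fC : f \in C by rewrite inE fX ref.
have cfd : coloopfree r (X :\ e).
  (* Deleting [e] can create a coloop only at [f], since [f] spans [e]; [no_digon] excludes that
     one. *)
  move=> h /setD1P[he hX]; rewrite (cf e eX); have [->|hf] := eqVneq h f; first exact: nd.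
  rewrite -(cf h hX); have -> : X :\ h = e |: (X :\ e :\ h).
    by apply/setP=> z; rewrite !inE; case: (eqVneq z e) => [->|]; rewrite // eX eq_sym he.
  apply/esym; apply: (@closure_mono _ _ e [set f]) => //.
    by rewrite sub1set !inE fX eq_sym hf eq_sym ef.
  by rewrite ref lf.
have sZX : e |: X :\: C \subset X by rewrite subUset sub1set eX subsetDl.
have lo : tutte20 r (X :\: C) + tutte20 (contract r [set e]) (X :\: C) <= tutte20 r X.
  by rewrite -tutte20U1 ?inE ?eX ?re ?setUid ?re ?andbF // tutte20_subset.
(* With at least three parallel elements the loops give a factor 4, and [k = 2] suffices because
   deletion dominates contraction. With two they give only 2, and the triangle raises [k] to 3. *)
have [C3|C2] := ltnP 2 #|C|.
  apply: (@parallel_class_bound r e X 2) => //; rewrite -/C; first exact: ltnW.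
    have -> : #|C|.-1 = (2 + (#|C|.-1 - 2))%N by lia.
    by rewrite expnD; have := expn_gt0 2 (#|C|.-1 - 2); lia.
  by have := tutte20_contract_le e (X :\: C) hr; lra.
have CE : C = [set e; f].
  apply/esym/eqP; rewrite eqEcard cards2 ef C2 andbT.
  by apply/subsetP=> z; rewrite !inE => /orP[/eqP->|/eqP->]; rewrite ?eX ?fX ?setUid ?re ?ref.
have C2' : #|C| = 2%N by rewrite CE cards2 ef.
have ZE : X :\: C = X :\ e :\ f by rewrite CE setDDl.
apply: (@parallel_class_bound r e X 3) => //; rewrite -/C ?C2' //.
have := @tutte20_contract_triangle _ r e x y (X :\: C) hr.
by rewrite ZE => /(_ xZ yZ re cl); move: lo; rewrite ZE; lra.
Qed.

End Reduction.

(** * Series pairs and counting bases *)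

Section PairLists.
Variable T : finType.
Implicit Types (A B C D W X Y Z : {set T}) (e f g h x y : T) (r : {set T} -> nat).
Implicit Types (p q : T * T) (l : seq (T * T)).

Fixpoint pair_seq l : seq T := if l is p :: l' then [:: p.1, p.2 & pair_seq l'] else [::].

Fixpoint add_pairs l Z : {set T} :=
  if l is p :: l' then p.1 |: (p.2 |: add_pairs l' Z) else Z.

Definition pair_set p : {set T} := [set p.1; p.2].

Lemma in_add_pairs l Z x : (x \in add_pairs l Z) = (x \in pair_seq l) || (x \in Z).
Proof. by elim: l => //= p l IH; rewrite !inE IH !orbA. Qed.

Lemma mem_pair_seq l p : p \in l -> p.1 \in pair_seq l /\ p.2 \in pair_seq l.
Proof.
elim: l => //= q l IH; rewrite !inE => /predU1P[->|/IH[-> ->]]; rewrite ?eqxx ?orbT //.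
Qed.

Definition disjoint_pairs l Z := uniq (pair_seq l) && [forall x in Z, x \notin pair_seq l].

Lemma disjoint_pairs_cons p l Z : disjoint_pairs (p :: l) Z ->
  [/\ p.1 \notin p.2 |: add_pairs l Z, p.2 \notin p.1 |: add_pairs l Z & disjoint_pairs l Z].
Proof.
move=> /andP[/=]; rewrite inE negb_or => /and3P[/andP[n12 n1] n2 u] /forall_inP d.
have nZ x : x \in [:: p.1, p.2 & pair_seq l] -> x \notin Z by apply: contraL => /d.
have n21 : p.2 != p.1 by rewrite eq_sym.
rewrite !inE !in_add_pairs !negb_or n1 n2 n12 n21 !nZ ?inE ?eqxx ?orbT //.
split=> //; rewrite /disjoint_pairs u; apply/forall_inP=> x /d /=.
by rewrite !inE !negb_or => /and3P[].
Qed.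

(* Every circuit of [r] inside [X] containing one element of a pair contains the other. *)
Definition series_pairs r X l := forall p, p \in l -> forall A, A \subset X ->
  p.1 \notin A -> p.2 \notin A -> r (p.1 |: A) = (r A).+1 /\ r (p.2 |: A) = (r A).+1.

Lemma series_pairs_cons r p l Z : series_pairs r (add_pairs (p :: l) Z) (p :: l) ->
  series_pairs r (add_pairs l Z) l.
Proof.
move=> h q ql A sA; apply: h; rewrite ?inE ?ql ?orbT //.
by rewrite (subset_trans sA) //= setUA subsetUr.
Qed.

Lemma series_pairs_contract r p l Z : is_rank r -> disjoint_pairs (p :: l) Z ->
  series_pairs r (add_pairs (p :: l) Z) (p :: l) ->
  series_pairs (contract r (pair_set p)) (add_pairs l Z) l.
Proof.
move=> hr dl h q ql A sA q1 q2.
have [n1 n2 dl'] := disjoint_pairs_cons dl; have [m1 m2] := mem_pair_seq ql.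
have notp x : x \in pair_seq l -> x \notin pair_set p.
  move=> xl; rewrite !inE; apply/negP=> /orP[/eqP E|/eqP E].
    by move: n1; rewrite -E !inE in_add_pairs xl orbT.
  by move: n2; rewrite -E !inE in_add_pairs xl orbT.
have sub : A :|: pair_set p \subset add_pairs (p :: l) Z.
  by rewrite /pair_set setUC -setUA /= !setUS.
have a1 : q.1 \notin A :|: pair_set p by rewrite in_setU negb_or q1 notp.
have a2 : q.2 \notin A :|: pair_set p by rewrite in_setU negb_or q2 notp.
have ql' : q \in p :: l by rewrite inE ql orbT.
have [h1 h2] := h q ql' _ sub a1 a2.
have := contractE (pair_set p) A hr; have := contractE (pair_set p) (q.1 |: A) hr.
have := contractE (pair_set p) (q.2 |: A) hr; rewrite -!setUA h1 h2; clear; lia.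
Qed.

Lemma tutte20_series_pow2 r l Z : is_rank r -> disjoint_pairs l Z ->
  series_pairs r (add_pairs l Z) l ->
  2 ^+ size l * tutte20 r Z <= tutte20 r (add_pairs l Z).
Proof.
move=> hr; elim: l => [|p l IH] dl h; first by rewrite mul1r.
have [n1 n2 dl'] := disjoint_pairs_cons dl; have IH' := IH dl' (series_pairs_cons h).
have n2' : p.2 \notin add_pairs l Z by apply: contra n2; rewrite in_setU1 orbC => ->.
have n1' : p.1 \notin add_pairs l Z by apply: contra n1; rewrite in_setU1 orbC => ->.
have [|||_ h2] := h p (mem_head _ _) (add_pairs l Z); rewrite //=.
  by rewrite setUA subsetUr.
have [|||h1 _] := h p (mem_head _ _) set0; rewrite ?inE ?sub0set //.
rewrite setU0 rank0 // in h1.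
rewrite tutte20U1 // (tutte20_coloop hr n2' h2) exprS -mulrA.
apply: le_trans (_ : 2 * tutte20 r (add_pairs l Z) <= _); first by rewrite ler_pM2l.
by rewrite lerDl tutte20_ge0 //; apply: contract_is_rank.
Qed.

(** Deleting one element of a pair makes the other a coloop, contributing twice the value without
    the pair. Contracting one and deleting the other contributes it once more, and contracting both
    contributes at least [2 ^+ size l * k] by [tutte20_series_pow2]. The bound solves the recurrence
    [a(n+1) = 3 a(n) + 2^n k]. *)
Lemma tutte20_series_lower_bound r l Z (k : int) : is_rank r -> disjoint_pairs l Z ->
  series_pairs r (add_pairs l Z) l -> (forall p, p \in l -> r (pair_set p) = 2%N) ->
  (forall p, p \in l -> k <= tutte20 (contract r (pair_set p)) Z) ->
  3 ^+ size l * tutte20 r Z + (3 ^+ size l - 2 ^+ size l) * k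
    <= tutte20 r (add_pairs l Z).
Proof.
move=> hr; elim: l => [|p l IH] dl h r2 hk; first by rewrite /= subrr mul0r mul1r addr0.
have [n1 n2 dl'] := disjoint_pairs_cons dl.
have IH' : 3 ^+ size l * tutte20 r Z + (3 ^+ size l - 2 ^+ size l) * k
    <= tutte20 r (add_pairs l Z).
  apply: IH dl' (series_pairs_cons h) _ _ => q ql; [apply: r2|apply: hk];
  by rewrite inE ql orbT.
have n2' : p.2 \notin add_pairs l Z by apply: contra n2; rewrite in_setU1 orbC => ->.
have n1' : p.1 \notin add_pairs l Z by apply: contra n1; rewrite in_setU1 orbC => ->.
have [|||h1 h2] := h p (mem_head _ _) (add_pairs l Z); rewrite //=.
  by rewrite setUA subsetUr.
have [|||e1 e2] := h p (mem_head _ _) set0; rewrite ?inE ?sub0set //.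
rewrite setU0 rank0 // in e1.
have hr1 := contract_is_rank [set p.1] hr.
have r12 : contract r [set p.1] [set p.2] = 1%N.
  by rewrite /contract setUC r2 ?mem_head // e1.
rewrite tutte20U1 // (tutte20_coloop hr n2' h2) (tutte20U1 hr1 n2' r12).
rewrite (eq_tutte20 (fun A => contract_coloop hr h1)).
rewrite (@eq_tutte20 _ (contract (contract r _) _) (contract r (pair_set p))) => [|A _]; last first.
  exact: contract_contract.
have := tutte20_series_pow2 (contract_is_rank (pair_set p) hr) dl'
  (series_pairs_contract hr dl h).
have := ler_wpM2l (exprn_ge0 (size l) (ler0n int 2)) (hk p (mem_head _ _)).
rewrite !exprS; move: IH'.
move: (3 ^+ size l) (2 ^+ size l) (tutte20 _ _) (tutte20 _ _) (tutte20 _ _) (tutte20 _ _).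
move=> a b c d t u; clear; lia.
Qed.

End PairLists.

(** * Bounding the number of bases by block intersections *)

Section Counting.
Variable T : finType.
Implicit Types (A B C D W X Y Z : {set T}) (r : {set T} -> nat).
Implicit Types (b : {set T} * bool) (s : seq ({set T} * bool)).

(** The flag [true] marks a series block, which a basis must meet; [false] marks a parallel block,
    which it meets at most once. *)
Definition block_size_ok (t : bool) (k : nat) : bool := if t then (0 < k)%N else (k <= 1)%N.

(** The sum runs over a concrete list so that [vm_compute] can evaluate it in the numerical
    checks. *)
Fixpoint block_count (w : seq (nat * bool)) (n : nat) : nat :=
  if w is (m, t) :: w' then
    sumn [seq (if block_size_ok t k && (k <= n)%N
               then 'C(m, k) * block_count w' (n - k) else 0)%N | k <- iota 0 m.+1]
  else n == 0%N.

Lemma block_count_cons m t w n : block_count ((m, t) :: w) n =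
  (\sum_(k < m.+1) if block_size_ok t k && (k <= n)%N
                   then 'C(m, k) * block_count w (n - k) else 0)%N.
Proof.
pose F k := (if block_size_ok t k && (k <= n)%N
             then 'C(m, k) * block_count w (n - k) else 0)%N.
transitivity (sumn [seq F k | k <- iota 0 m.+1]) => //.
by rewrite sumnE big_map -(big_mkord xpredT F) /index_iota subn0.
Qed.

Arguments block_count : simpl never.

Fixpoint block_union s : {set T} := if s is b :: s' then b.1 :|: block_union s' else set0.

Lemma block_union_sup s b : b \in s -> b.1 \subset block_union s.
Proof.
elim: s => //= c s IH; rewrite inE => /predU1P[->|/IH sub]; first exact: subsetUl.
by rewrite (subset_trans sub) ?subsetUr.
Qed.

Fixpoint disjoint_blocks s : bool :=
  if s is b :: s' then [disjoint b.1 & block_union s'] && disjoint_blocks s' else true.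

Definition block_sizes s : seq (nat * bool) := [seq (#|b.1|, b.2) | b <- s].

Definition block_sets s n : {set {set T}} :=
  [set A : {set T} | [&& A \subset block_union s, #|A| == n &
                         all (fun b => block_size_ok b.2 #|A :&: b.1|) s]].

(** The sets are sorted by the size of their trace on the first block, and [A] is recovered from its
    trace and the rest. *)
Lemma block_setsP s n : disjoint_blocks s ->
  (#|block_sets s n| <= block_count (block_sizes s) n)%N.
Proof.
elim: s n => [|[B t] s IH] n; rewrite [block_sizes _]/=.
  rewrite /block_count => _; have [->|n0] := eqVneq n 0%N.
    apply: leq_trans (_ : #|[set (set0 : {set T})]| <= _)%N; last by rewrite cards1.
    apply: subset_leq_card.
    by apply/subsetP=> A; rewrite !inE subset0 => /and3P[].
  rewrite leqn0 cards_eq0; apply/eqP/setP=> A; rewrite !inE subset0 andbT.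
  by apply/negP=> /andP[/eqP->]; rewrite cards0 eq_sym (negPf n0).
rewrite block_count_cons => /andP[dB /IH {}IH]; rewrite /= in dB.
have sizeB A : (#|A :&: B| < #|B|.+1)%N by rewrite ltnS subset_leq_card ?subsetIr.
rewrite -sum1_card (partition_big (fun A => Ordinal (sizeB A)) predT) //=.
apply: leq_sum => k _; rewrite sum1dep_card.
case: ifP => [/andP[tk kn]|nk]; last first.
  rewrite leqn0 cards_eq0; apply/eqP/setP=> A; rewrite !inE.
  apply/negP=> /andP[/and3P[_ /eqP An /andP[tA _]] /eqP kA].
  have Ek : #|A :&: B| = k by rewrite -kA.
  by move: nk; rewrite -Ek tA -An subset_leq_card ?subsetIl.
rewrite -cards_draws; set L := [set D : {set T} | _].
apply: leq_trans (_ : (#|setX L (block_sets s (n - k))| <= _)%N); last first.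
  by rewrite cardsX leq_mul.
set S := [set A : {set T} | _].
rewrite -(@card_in_imset _ _ (fun A : {set T} => (A :&: B, A :\: B)) S) => [|A A' _ _ [E1 E2]].
  apply: subset_leq_card; apply/subsetP=> _ /imsetP[A AS ->].
  move: AS; rewrite !inE => /andP[/and3P[sA /eqP An /andP[_ allA]] /eqP kA].
  have Ek : #|A :&: B| = k by rewrite -kA.
  rewrite subsetIr Ek eqxx /=; apply/and3P; split.
  - by rewrite subDset.
  - by have := cardsID B A; rewrite Ek An => <-; rewrite addKn.
  apply/allP=> b bs; have := allP allA b bs; congr (block_size_ok _ #|pred_of_set _|).
  apply/setP=> x; rewrite !inE; case xb: (x \in b.1); rewrite ?andbF // !andbT.
  suff -> : x \notin B by [].
  apply: contraL xb => xB.
  have : x \notin block_union s by rewrite (disjointFr dB xB).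
  by apply: contra; apply: subsetP (block_union_sup bs) x.
by rewrite -(setID A B) -(setID A' B) E1 E2.
Qed.

Lemma independent_subset r A B : is_rank r -> r A = #|A| -> B \subset A -> r B = #|B|.
Proof.
move=> hr iA sBA; apply/eqP; rewrite eqn_leq rank_card //.
have EA : B :|: A :\: B = A by rewrite -{2}(setID A B) (setIidPr sBA).
have := rankU_le B (A :\: B) hr; have := rank_card (A :\: B) hr.
by have := cardsID B A; rewrite (setIidPr sBA) EA; lia.
Qed.

(** A basis missing a series block would lie in a set of smaller rank. Blocks may have any size,
    because contracting a series pair can merge two parallel pairs. *)
Lemma nbases_block_count r s : is_rank r -> disjoint_blocks s ->
  (forall b, b \in s -> if b.2 then (r (block_union s :\: b.1) < r (block_union s))%N
                        else (r b.1 <= 1)%N) ->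
  (nbases r (block_union s) <= block_count (block_sizes s) (r (block_union s)))%N.
Proof.
move=> hr ds hb; apply: leq_trans (block_setsP _ ds).
rewrite /nbases -big_mkcondr /= sum1dep_card subset_leq_card //.
apply/subsetP=> A; rewrite !inE => /and3P[sA /eqP iA /eqP bA].
rewrite sA -iA bA eqxx; apply/allP=> b bs; have := hb b bs.
case: b.2 => hB /=.
  rewrite lt0n cards_eq0; apply: contraTneq hB => AB; rewrite -leqNgt -bA.
  by apply: rank_mono => //; rewrite subsetD sA -setI_eq0 AB eqxx.
rewrite -(independent_subset hr iA (subsetIl A b.1)).
by apply: leq_trans hB; apply: rank_mono => //; apply: subsetIr.
Qed.

End Counting.

(** * Matroids made of parallel and series pairs *)

Section PairedMatroids.
Variable T : finType.
Implicit Types (A B C D P W X Y Z : {set T}) (e f g h x y : T) (r : {set T} -> nat).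
Implicit Types (p q : T * T) (l lp ls : seq (T * T)).

Definition firsts l : {set T} := [set x in [seq p.1 | p <- l]].
Definition pair_support l : {set T} := [set x in pair_seq l].

Lemma mem_pair_seqP l x : x \in pair_seq l -> exists2 p : T * T, p \in l & x \in pair_set p.
Proof.
elim: l => //= p l IH; rewrite !inE orbA => /orP[xp|/IH[q ql xq]].
  by exists p; rewrite ?mem_head // !inE.
by exists q; rewrite // inE ql orbT.
Qed.

Lemma mem_pair_seq_pair l p x : p \in l -> x \in pair_set p -> x \in pair_seq l.
Proof. by move=> /mem_pair_seq[h1 h2]; rewrite !inE => /orP[/eqP->|/eqP->]. Qed.

Lemma uniq_pair_seq_pair l p q x : uniq (pair_seq l) -> p \in l -> q \in l ->
  x \in pair_set p -> x \in pair_set q -> p = q.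
Proof.
elim: l => //= a l IH; rewrite inE negb_or => /and3P[/andP[n12 n1] n2 u].
have na z : z \in pair_set a -> z \notin pair_seq l by rewrite !inE => /orP[/eqP->|/eqP->].
rewrite !inE -!in_set2 => /predU1P[->|pl] /predU1P[->|ql] //= xp xq.
- by case/negP: (na x xp); apply: mem_pair_seq_pair xq.
- by case/negP: (na x xq); apply: mem_pair_seq_pair xp.
exact: IH.
Qed.

Lemma uniq_pair_seq_neq l p : uniq (pair_seq l) -> p \in l -> p.1 != p.2.
Proof.
elim: l => //= a l IH; rewrite inE negb_or => /and3P[/andP[n12 n1] n2 u].
by rewrite inE => /predU1P[->|/IH->].
Qed.

Lemma firstsP l x : reflect (exists2 p : T * T, p \in l & x = p.1) (x \in firsts l).
Proof. by rewrite inE; apply: mapP. Qed.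

Lemma firsts_pair_seq l : firsts l \subset pair_support l.
Proof. by apply/subsetP=> x /firstsP[p pl ->]; rewrite inE; case: (mem_pair_seq pl). Qed.

Lemma uniq_firsts l : uniq (pair_seq l) -> uniq [seq p.1 | p <- l].
Proof.
elim: l => //= a l IH; rewrite inE negb_or => /and3P[/andP[n12 n1] n2 u].
rewrite IH // andbT; apply: contra n1 => /mapP[p pl ->].
by case: (mem_pair_seq pl).
Qed.

Lemma card_firsts l : uniq (pair_seq l) -> #|firsts l| = size l.
Proof.
move=> u; rewrite /firsts cardsE.
by have /card_uniqP -> := uniq_firsts u; rewrite size_map.
Qed.

Lemma size_pair_seq l : size (pair_seq l) = (size l).*2.
Proof. by elim: l => //= p l ->. Qed.

Lemma card_pair_seq l : uniq (pair_seq l) -> #|pair_support l| = (size l).*2.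
Proof. by move=> u; rewrite /pair_support cardsE; have /card_uniqP -> := u; rewrite size_pair_seq. Qed.

Definition simple_up_to3 r P : Prop := forall A, A \subset P -> (#|A| <= 3)%N -> r A = #|A|.

Lemma simple_up_to3P r P : is_rank r -> loopfree r P ->
  (forall e x y, e \in P -> x \in P -> y \in P -> e != x -> e != y ->
     r (e |: [set x; y]) != r [set x; y]) -> simple_up_to3 r P.
Proof.
move=> hr lf h A; have [n] := ubnP #|A|; elim: n A => // n IH A ltA sA A3.
have [->|[e eA]] := set_0Vmem A; first by rewrite rank0 // cards0.
have eP := subsetP sA e eA; have cA := cardsD1 e A; rewrite eA in cA.
have sAe : A :\ e \subset P by rewrite (subset_trans (subsetDl _ _)).
have rAe : r (A :\ e) = #|A :\ e| by apply: IH => //; lia.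
have [E|[x xA]] := set_0Vmem (A :\ e).
  by rewrite -(setD1K eA) E setU0 lf // cards1.
have [y yA Exy] : exists2 y, y \in A :\ e & A :\ e = [set x; y].
  have cx := cardsD1 x (A :\ e); rewrite xA in cx.
  have [E|[y yA]] := set_0Vmem (A :\ e :\ x).
    by exists x => //; rewrite -(setD1K xA) E setU0 setUid.
  have cy := cardsD1 y (A :\ e :\ x); rewrite yA in cy.
  exists y; first by move: yA => /setD1P[].
  rewrite -(setD1K xA) -(setD1K yA); congr (_ |: _).
  have -> : A :\ e :\ x :\ y = set0 by apply/eqP; rewrite -cards_eq0; apply/eqP; lia.
  by rewrite setU0.
have /setD1P[xe xA'] := xA; have /setD1P[ye yA'] := yA.
have := h e x y eP (subsetP sA x xA') (subsetP sA y yA').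
rewrite !(eq_sym e) xe ye -Exy setD1K // => /(_ isT isT).
have := rankU1_le e (A :\ e) hr; have := rankU1_ge e (A :\ e) hr.
by rewrite setD1K // rAe cA; lia.
Qed.

Lemma simple_rank r P : is_rank r -> (#|P| <= 4)%N -> simple_up_to3 r P ->
  r P = #|P| \/ #|P| = 4%N /\ r P = 3%N.
Proof.
move=> hr P4 s; have [P3|P3] := leqP #|P| 3; first by left; apply: s.
have [e eP] : exists e, e \in P by apply/card_gt0P; lia.
have := cardsD1 e P; rewrite eP /= add1n => cP.
have rPe : r (P :\ e) = #|P :\ e| by apply: s; [apply: subsetDl | lia].
have := rank_mono hr (subsetDl P [set e]); have := rank_card P hr; lia.
Qed.

(** The 15 proper subsets are independent and contribute 1 each; the whole set contributes -1. *)
Lemma tutte20_circuit4 r P : #|P| = 4%N -> r P = 3%N -> simple_up_to3 r P -> tutte20 r P = 14.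
Proof.
move=> P4 rP s; rewrite /tutte20 (bigD1 P) //= P4 rP.
rewrite (eq_bigr (fun=> 1)) => [|A /andP[sA neA]].
  rewrite sumr_const -[X in _ *+ X]/(#|_|).
  have := cardsD1 P (powerset P); rewrite card_powerset P4 powersetE subxx.
  have -> : #|powerset P :\ P| = #|[pred A : {set T} | (A \subset P) && (A != P)]|.
    by apply: eq_card => A; rewrite !inE andbC.
  by rewrite -[(2 ^ 4)%N]/16%N add1n => -[<-].
have ltA : (#|A| < #|P|)%N by rewrite proper_card // properEneq neA.
by rewrite s //; [rewrite addnn -signr_odd odd_double | rewrite P4 in ltA].
Qed.

Lemma coloops_independent r P : is_rank r -> (forall e, e \in P -> r (P :\ e) != r P) ->
  r P = #|P|.
Proof.
move=> hr h; suff : forall A, A \subset P -> r A = #|A| by apply.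
move=> A; have [n] := ubnP #|A|; elim: n A => // n IH A ltA sA.
have [->|[e eA]] := set_0Vmem A; first by rewrite rank0 // cards0.
have cA := cardsD1 e A; rewrite eA in cA; have eP := subsetP sA e eA.
have rAe : r (A :\ e) = #|A :\ e|.
  by apply: IH; [lia | rewrite (subset_trans (subsetDl _ _))].
have := rankU_mono [set e] hr (setSD [set e] sA); rewrite !setD1K //.
have := h e eP; have := rank_mono hr (subsetDl P [set e]); have := rank_card A hr; lia.
Qed.

(** In rank 3 some element is not a coloop; its deletion gives at least [2 ^ 3] and its loop-free
    contraction at least [2 ^ 2]. A triangle with a coloop attains 12. *)
Lemma tutte20_ge12 r P : is_rank r -> #|P| = 4%N -> (3 <= r P)%N -> loopfree r P ->
  (forall x y, x \in P -> y \in P -> x != y -> r [set x; y] != 1%N) -> 12 <= tutte20 r P.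
Proof.
move=> hr P4 rP lf np; have := tutte20_ge_pow2 hr lf; have := rank_card P hr; rewrite P4 => rP4.
have [->|r4 _] := eqVneq (r P) 4%N; first by apply: le_trans.
have {}rP : r P = 3%N by move: r4; lia.
case: (boolP [exists e in P, r (P :\ e) == r P]) => [/exists_inP[e eP /eqP re]|/exists_inPn h].
  have hre := contract_is_rank [set e] hr.
  rewrite (tutte20D1 hr eP) ?lf //.
  have := @tutte20_ge_pow2 _ r (P :\ e) hr (fun x xP => lf x (subsetP (subsetDl _ _) x xP)).
  have lfc : loopfree (contract r [set e]) (P :\ e).
    move=> x /setD1P[xe xP]; have := contractE [set e] [set x] hr.
    rewrite lf //; have := np x e xP eP xe.
    have := rankU_le [set x] [set e] hr; rewrite !lf //.
    have : (r [set x] <= r [set x; e])%N by rewrite rank_mono ?subsetUl.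
    by rewrite lf //; lia.
  have := contractE [set e] (P :\ e) hr; rewrite setUC setD1K // rP lf // => E.
  have := tutte20_ge_pow2 hre lfc; have -> : contract r [set e] (P :\ e) = 2%N by lia.
  rewrite re rP; lia.
by have := coloops_independent hr h; rewrite rP P4.
Qed.

(** The conditions are kept symmetric under duality, so that [paired_dual] exchanges the two lists
    and every later bound serves both sides. *)
Record paired r X lp ls : Prop := Paired {
  paired_rank : is_rank r;
  paired_loopfree : loopfree r X;
  paired_coloopfree : coloopfree r X;
  paired_width : cyclic_width_lt8 r X;
  paired_thin : thin r X;
  paired_thin_dual : thin (dual r X) X;
  paired_no_digon : no_digon r X;
  paired_uniq : uniq (pair_seq lp ++ pair_seq ls);
  paired_mem : forall x, (x \in X) = (x \in pair_seq lp ++ pair_seq ls);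
  paired_parallel : forall p, p \in lp -> r (pair_set p) = 1%N;
  paired_series : forall p, p \in ls -> dual r X (pair_set p) = 1%N }.

Section Paired.
Variables (r : {set T} -> nat) (X : {set T}) (lp ls : seq (T * T)).
Hypothesis pr : paired r X lp ls.
Let hr := paired_rank pr.
Let lf := paired_loopfree pr.

Let up : uniq (pair_seq lp).
Proof. by have := paired_uniq pr; rewrite cat_uniq => /and3P[]. Qed.
Let us : uniq (pair_seq ls).
Proof. by have := paired_uniq pr; rewrite cat_uniq => /and3P[]. Qed.

Lemma paired_pair_seq_disjoint x : x \in pair_seq lp -> x \notin pair_seq ls.
Proof.
move=> xp; have := paired_uniq pr; rewrite cat_uniq => /and3P[_ /hasPn d _].
by apply: contraL xp => /d.
Qed.

Lemma paired_pair_sub p : p \in lp -> pair_set p \subset X.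
Proof.
by move=> pl; apply/subsetP=> x /(mem_pair_seq_pair pl) xf; rewrite (paired_mem pr) mem_cat xf.
Qed.

Lemma paired_series_sub p : p \in ls -> pair_set p \subset X.
Proof.
by move=> pl; apply/subsetP=> x /(mem_pair_seq_pair pl) xf; rewrite (paired_mem pr) mem_cat xf orbT.
Qed.

Lemma paired_dual : paired (dual r X) X ls lp.
Proof.
have hd := dual_is_rank X hr.
split=> //.
- exact/dual_loopfree/(paired_coloopfree pr).
- exact: dual_coloopfree.
- exact/width_dual/(paired_width pr).
- exact: paired_thin_dual pr.
- move=> e f x y eX fX ef; rewrite dual_dual ?subUset ?sub1set ?eX ?fX // => h xZ yZ.
  have xX : x \in X by move: xZ; rewrite !inE => /and3P[].
  have yX : y \in X by move: yZ; rewrite !inE => /and3P[].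
  rewrite !dual_dual ?subUset ?sub1set ?eX ?xX ?yX //.
  exact: (paired_thin pr eX fX ef h xZ yZ).
(* Being at once a parallel and a series pair is a self-dual property. *)
- move=> e f eX fX ef def.
  have sef : [set e; f] \subset X by rewrite subUset !sub1set eX.
  have sC : X :\: [set e; f] \subset X by apply: subsetDl.
  have E : X :\ e :\ f = X :\: [set e; f] by rewrite setDDl.
  have := dualE hr sef; have := dualE hr sC; have := dualE hr (subxx X).
  rewrite E def setDv rank0 // setDDr setDv set0U (setIidPr sef) cards2 ef.
  have cX := cardsID [set e; f] X; rewrite (setIidPr sef) cards2 ef in cX.
  have := rankU_le [set e] [set f] hr; rewrite !lf //.
  have : (r [set e] <= r [set e; f])%N by rewrite rank_mono ?subsetUl.
  rewrite lf //.
  have := @paired_no_digon _ _ _ _ pr e f eX fX ef; rewrite E.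
  case: (r [set e; f]) => [|[|[|]]] // nd; lia.
- by rewrite uniq_catC (paired_uniq pr).
- by move=> x; rewrite (paired_mem pr) !mem_cat orbC.
- exact: paired_series pr.
- by move=> p pl; rewrite dual_dual ?paired_pair_sub // (paired_parallel pr).
Qed.

Lemma paired_thin_pair p x y : p \in lp -> x \in X -> y \in X ->
  x \notin pair_set p -> y \notin pair_set p -> r (p.1 |: [set x; y]) != r [set x; y].
Proof.
move=> pl xX yX; have := paired_pair_sub pl; rewrite subUset !sub1set => /andP[p1 p2].
rewrite !inE !negb_or => /andP[x1 x2] /andP[y1 y2].
apply: (paired_thin pr) p1 p2 (uniq_pair_seq_neq up pl) (paired_parallel pr pl) _ _;
by rewrite !inE ?x1 ?x2 ?y1 ?y2.
Qed.

Lemma firsts_sub : firsts lp \subset X.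
Proof.
by apply/subsetP=> x /firstsP[p pl ->]; apply: subsetP (paired_pair_sub pl) _ _; rewrite !inE eqxx.
Qed.

Lemma paired_simple : simple_up_to3 r (firsts lp).
Proof.
apply: simple_up_to3P => // [e /(subsetP firsts_sub)/lf //|].
move=> e x y /firstsP[p pl ->] xP yP ex ey.
apply: paired_thin_pair => //; rewrite ?(subsetP firsts_sub) //.
- case/firstsP: xP ex => q ql -> ne; apply: contra ne => /(uniq_pair_seq_pair up ql pl).
  by rewrite !inE eqxx => ->.
- case/firstsP: yP ey => q ql -> ne; apply: contra ne => /(uniq_pair_seq_pair up ql pl).
  by rewrite !inE eqxx => ->.
Qed.

Lemma paired_closure A x : firsts lp \subset A -> x \in pair_seq lp -> r (x |: A) = r A.
Proof.
move=> sA /mem_pair_seqP[p pl xp]; apply: (@closure_mono _ r x [set p.1]) => //.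
  by rewrite sub1set (subsetP sA) //; apply/firstsP; exists p.
have p1 : p.1 \in X by rewrite (subsetP firsts_sub) //; apply/firstsP; exists p.
apply/eqP; rewrite eqn_leq rankU1_ge // andbT lf // -(paired_parallel pr pl).
by apply: rank_mono; rewrite // subUset !sub1set xp !inE eqxx.
Qed.

Lemma paired_rank_pair_seq A : r (pair_support lp :|: A) = r (firsts lp :|: A).
Proof.
have -> : pair_support lp :|: A = (firsts lp :|: A) :|: pair_support lp.
  by rewrite setUAC (setUidPr (firsts_pair_seq _)).
by apply: closureU => // x; rewrite inE => /paired_closure; apply; apply: subsetUl.
Qed.

(* Five pairs span ten pairwise incomparable cyclic sets of rank 2; [ab] lists eight of them. *)
Lemma paired_size : (size lp <= 4)%N.
Proof.
rewrite leqNgt; apply/negP=> lp5.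
have [p0 _] : exists p0, p0 \in lp by case: (lp) lp5 => // p l _; exists p; rewrite mem_head.
pose c (i : nat) := nth p0 lp i.
have cl i : (i < 5)%N -> c i \in lp by move=> i5; rewrite mem_nth // (leq_trans i5).
have c_inj i j : (i < 5)%N -> (j < 5)%N -> c i = c j -> i = j.
  move=> i5 j5 /eqP; rewrite nth_uniq ?(leq_trans i5) ?(leq_trans j5) // => [/eqP//|].
  exact: map_uniq (uniq_firsts up).
pose ab := [:: (0, 1); (0, 2); (0, 3); (0, 4); (1, 2); (1, 3); (1, 4); (2, 3)]%N.
pose F (i : 'I_8) := pair_set (c (nth (0, 0)%N ab i).1) :|: pair_set (c (nth (0, 0)%N ab i).2).
have lt5 (i : 'I_8) : ((nth (0, 0)%N ab i).1 < 5)%N && ((nth (0, 0)%N ab i).2 < 5)%N.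
  by case: i => -[|[|[|[|[|[|[|[|]]]]]]]].
have [|i [j [ij rij]]] := paired_width pr (F := F).
  move=> i; have /andP[/cl a5 /cl b5] := lt5 i.
  split; first by rewrite subUset !paired_pair_sub.
  have cyc p A x : p \in lp -> x \in pair_set p -> pair_set p \subset A -> r (A :\ x) = r A.
    move=> pl xp sA; have [y yp yx] : exists2 y, y \in pair_set p & y != x.
      have := uniq_pair_seq_neq up pl; move: xp; rewrite !inE => /orP[/eqP->|/eqP->] ne.
        by exists p.2; rewrite ?inE ?eqxx ?orbT // eq_sym.
      by exists p.1; rewrite ?inE ?eqxx.
    rewrite -{2}(setD1K (subsetP sA x xp)); apply/esym/(@closure_mono _ r x [set y]) => //.
      by rewrite sub1set !inE yx (subsetP sA).
    rewrite (lf (subsetP (paired_pair_sub pl) y yp)).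
    apply/eqP; rewrite eqn_leq -{1}(paired_parallel pr pl) rank_mono ?subUset ?sub1set ?xp //=.
    by rewrite -(lf (subsetP (paired_pair_sub pl) y yp)) rankU1_ge.
  by move=> x; rewrite in_setU => /orP[xp|xp]; apply: cyc xp _; rewrite ?subsetUl ?subsetUr.
have /andP[a5 b5] := lt5 j.
(* Distinct index pairs differ, so [F i] contains a pair [c k] outside [F j]. Its representative
   would lie in the closure of the two representatives of [F j], contradicting thinness. *)
have [k k5 [kij [ka kb]]] : exists2 k, (k < 5)%N & pair_set (c k) \subset F i /\
    k != (nth (0, 0)%N ab j).1 /\ k != (nth (0, 0)%N ab j).2.
  have /andP[a5' b5'] := lt5 i.
  pose other m n := ((nth (0, 0)%N ab m).1 \notin [:: (nth (0, 0)%N ab n).1; (nth (0, 0)%N ab n).2])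
                 || ((nth (0, 0)%N ab m).2 \notin [:: (nth (0, 0)%N ab n).1; (nth (0, 0)%N ab n).2]).
  have /allP all_other : all (fun m => all (fun n => (m != n) ==> other m n) (iota 0 8)) (iota 0 8).
    by [].
  have := all_other i; rewrite mem_iota ltn_ord => /(_ isT)/allP/(_ (j : nat)).
  rewrite mem_iota ltn_ord => /(_ isT); rewrite -[(i == j :> nat)]/(i == j) ij /other !inE !negb_or /=.
  case/orP=> /andP[h1 h2]; first by exists (nth (0, 0)%N ab i).1; rewrite // subsetUl.
  by exists (nth (0, 0)%N ab i).2; rewrite // subsetUr.
set a := (nth (0, 0)%N ab j).1 in a5 ka; set b := (nth (0, 0)%N ab j).2 in b5 kb.
have in1 m : (m < 5)%N -> (c m).1 \in firsts lp by move=> m5; apply/firstsP; exists (c m); rewrite ?cl.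
have notin m : (m < 5)%N -> k != m -> (c m).1 \notin pair_set (c k).
  move=> m5; apply: contra => h; apply/eqP/c_inj => //.
  by apply: (uniq_pair_seq_pair up (cl k k5) (cl m m5) h); rewrite !inE eqxx.
have : r ((c k).1 |: [set (c a).1; (c b).1]) != r [set (c a).1; (c b).1].
  by apply: paired_thin_pair; rewrite ?cl ?notin // (subsetP firsts_sub) ?in1.
have Fj : r (F j) = r [set (c a).1; (c b).1].
  have -> : F j = [set (c a).1; (c b).1] :|: F j.
    by apply/esym/setUidPr; rewrite subUset !sub1set !inE !eqxx ?orbT.
  apply: closureU => // x xF.
  have [m [m5 mab xm]] : exists m, [/\ (m < 5)%N, (c m).1 \in [set (c a).1; (c b).1] &
                                        x \in pair_set (c m)].
    by move: xF; rewrite in_setU => /orP[xm|xm]; [exists a|exists b]; rewrite ?set21 ?set22.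
  apply: (@closure_mono _ r x [set (c m).1]); rewrite ?sub1set // lf ?(subsetP firsts_sub) ?in1 //.
  apply/eqP; rewrite eqn_leq -{1}(paired_parallel pr (cl m m5)).
  rewrite rank_mono ?subUset ?sub1set ?xm ?inE ?eqxx //=.
  by rewrite -(lf (subsetP firsts_sub _ (in1 m m5))) rankU1_ge.
apply/negP; rewrite negbK eqn_leq rankU1_ge // andbT -Fj -rij.
apply: rank_mono => //; rewrite !subUset !sub1set; apply/and3P; split.
- by rewrite inE (subsetP kij) // !inE eqxx.
- by rewrite !inE !eqxx ?orbT.
- by rewrite !inE !eqxx ?orbT.
Qed.

(** Removing a series pair from [X] lowers the rank by one, and either element alone restores it. By
    diminishing returns the same gain of one holds over every subset avoiding the pair. *)
Lemma series_rank p A : p \in ls -> A \subset X -> p.1 \notin A -> p.2 \notin A ->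
  r (p.1 |: A) = (r A).+1 /\ r (p.2 |: A) = (r A).+1.
Proof.
move=> pl sA p1A p2A; have := paired_series_sub pl; rewrite subUset !sub1set => /andP[p1 p2].
have ne := uniq_pair_seq_neq us pl.
have sD : A \subset X :\: pair_set p.
  apply/subsetP=> x xA; rewrite !inE (subsetP sA) // andbT negb_or.
  by apply/andP; split; [apply: contraNneq p1A | apply: contraNneq p2A] => <-.
have e1 : r (p.1 |: (X :\: pair_set p)) = r X.
  rewrite -(paired_coloopfree pr p2); congr r; apply/setP=> x; rewrite !inE.
  by case: (eqVneq x p.1) => [->|]; rewrite ?p1 ?andbT.
have e2 : r (p.2 |: (X :\: pair_set p)) = r X.
  rewrite -(paired_coloopfree pr p1); congr r; apply/setP=> x; rewrite !inE.
  by case: (eqVneq x p.2) => [->|_]; rewrite ?orbF //= p2 eq_sym ne.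
have := dualE hr (paired_series_sub pl); rewrite (paired_series pr pl) cards2 ne.
have := rankU_mono [set p.1] hr sD; have := rankU_mono [set p.2] hr sD.
rewrite e1 e2; have := rankU1_le p.1 A hr; have := rankU1_le p.2 A hr; lia.
Qed.

Lemma series_rank2 p : p \in ls -> r (pair_set p) = 2%N.
Proof.
move=> pl; have := paired_series_sub pl; rewrite subUset !sub1set => /andP[p1 p2].
have ne := uniq_pair_seq_neq us pl.
have := paired_no_digon pr p1 p2 ne; rewrite setDDl -/(pair_set p) => nd.
have := dualE hr (paired_series_sub pl); rewrite (paired_series pr pl) cards2 ne.
have := rankU_le [set p.1] [set p.2] hr; rewrite !lf // -/(pair_set p).
have : (r [set p.1] <= r (pair_set p))%N by rewrite rank_mono ?subsetUl.
rewrite lf //; move: nd; lia.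
Qed.

Lemma paired_disjoint : disjoint_pairs ls (firsts lp).
Proof.
rewrite /disjoint_pairs us; apply/forall_inP=> x /(subsetP (firsts_pair_seq _)).
by rewrite inE => /paired_pair_seq_disjoint.
Qed.

Lemma paired_lower_bound (k : int) :
  (forall p, p \in ls -> k <= tutte20 (contract r (pair_set p)) (firsts lp)) ->
  3 ^+ size ls * tutte20 r (firsts lp) + (3 ^+ size ls - 2 ^+ size ls) * k <= tutte20 r X.
Proof.
have sub : add_pairs ls (firsts lp) \subset X.
  apply/subsetP=> x; rewrite in_add_pairs => /orP[xs|/(subsetP firsts_sub)//].
  by rewrite (paired_mem pr) mem_cat xs orbT.
move=> hk; apply: le_trans (tutte20_subset hr lf sub).
apply: tutte20_series_lower_bound => //; first exact: paired_disjoint.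
  by move=> p pl A sA; apply: series_rank; rewrite ?(subset_trans sA).
exact: series_rank2.
Qed.

(** A representative that became a loop would lie in the closure of [p.1] and [p.2], which thinness
    of its parallel pair forbids. *)
Lemma series_contract_loopfree p : p \in ls ->
  loopfree (contract r (pair_set p)) (firsts lp).
Proof.
move=> pl e /firstsP[q ql ->].
have := paired_series_sub pl; rewrite subUset !sub1set => /andP[p1 p2].
have nq x : x \in pair_set p -> x \notin pair_set q.
  move=> xp; apply/negP=> /(mem_pair_seq_pair ql) /paired_pair_seq_disjoint.
  by rewrite (mem_pair_seq_pair pl).
have := paired_thin_pair ql p1 p2 (nq _ (set21 _ _)) (nq _ (set22 _ _)).
have := rankU1_le q.1 (pair_set p) hr; have := rankU1_ge q.1 (pair_set p) hr.
rewrite -/(pair_set p) /contract; lia.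
Qed.

(** The pair has rank 2, but its first element is already independent of the representatives, so
    contracting the pair costs them at most one rank. *)
Lemma series_contract_rank p : p \in ls ->
  (r (firsts lp) <= (contract r (pair_set p) (firsts lp)).+1)%N.
Proof.
move=> pl; have := contractE (pair_set p) (firsts lp) hr; rewrite series_rank2 //.
have nf x : x \in pair_set p -> x \notin firsts lp.
  move=> xp; apply: contraL (mem_pair_seq_pair pl xp) => /(subsetP (firsts_pair_seq _)).
  by rewrite inE => /paired_pair_seq_disjoint.
have [h _] := series_rank pl firsts_sub (nf _ (set21 _ _)) (nf _ (set22 _ _)).
have : (r (p.1 |: firsts lp) <= r (firsts lp :|: pair_set p))%N.
  by rewrite rank_mono // setUC setUS // sub1set set21.
rewrite h; lia.
Qed.

Lemma paired_kappa p : p \in ls ->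
  2 ^+ (r (firsts lp)).-1 <= tutte20 (contract r (pair_set p)) (firsts lp).
Proof.
move=> pl; have hc := contract_is_rank (pair_set p) hr.
apply: le_trans (tutte20_ge_pow2 hc (series_contract_loopfree pl)).
rewrite ler_eXn2l ?ltr1n //.
by have := series_contract_rank pl; lia.
Qed.

End Paired.

Lemma paired_complement r X lp ls : paired r X lp ls -> X :\: pair_support ls = pair_support lp.
Proof.
move=> pr; apply/setP=> x; rewrite !inE (paired_mem pr) mem_cat.
by case xp: (x \in pair_seq lp); rewrite ?orbF ?andNb // (negPf (paired_pair_seq_disjoint pr xp)).
Qed.

(** This is the dual rank formula for the union of the series pairs, with each union of pairs
    replaced by its representatives, which span it. *)
Lemma paired_rank_eq r X lp ls : paired r X lp ls ->
  (r X + dual r X (firsts ls) = (size ls).*2 + r (firsts lp))%N.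
Proof.
move=> pr; have hr := paired_rank pr; have us := paired_uniq pr.
have sS : pair_support ls \subset X.
  by apply/subsetP=> x; rewrite inE (paired_mem pr) mem_cat orbC => ->.
have := dualE hr sS; rewrite (paired_complement pr) card_pair_seq; last first.
  by move: us; rewrite cat_uniq => /and3P[].
have := paired_rank_pair_seq pr set0; have := paired_rank_pair_seq (paired_dual pr) set0.
rewrite !setU0 => -> ->; lia.
Qed.

End PairedMatroids.

(** * Upper bounds on the number of bases of paired matroids *)

Section PairedMerinoWelsh.
Variable T : finType.
Implicit Types (A B C D P W X Y Z : {set T}) (e f g h x y : T) (r : {set T} -> nat).
Implicit Types (p q : T * T) (l lp ls : seq (T * T)).

Lemma perm_pair_seq l1 l2 : perm_eq l1 l2 -> perm_eq (pair_seq l1) (pair_seq l2).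
Proof.
have E l : pair_seq l = flatten [seq [:: p.1; p.2] | p <- l] by elim: l => //= p l ->.
by move=> h; rewrite !E; apply/perm_flatten/perm_map.
Qed.

Lemma paired_perm r X lp lp' ls ls' : perm_eq lp lp' -> perm_eq ls ls' ->
  paired r X lp ls -> paired r X lp' ls'.
Proof.
move=> hp hs pr.
have hcat : perm_eq (pair_seq lp ++ pair_seq ls) (pair_seq lp' ++ pair_seq ls').
  by apply: perm_cat; apply: perm_pair_seq.
case: pr => h1 h2 h3 h4 h5 h6 h7 h8 h9 h10 h11; split=> //.
- by rewrite -(perm_uniq hcat).
- by move=> x; rewrite h9 (perm_mem hcat).
- by move=> p; rewrite -(perm_mem hp); apply: h10.
- by move=> p; rewrite -(perm_mem hs); apply: h11.
Qed.

Definition pair_blocks (b : bool) l : seq ({set T} * bool) := [seq (pair_set p, b) | p <- l].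

Lemma block_union_cat (s1 s2 : seq ({set T} * bool)) :
  block_union (s1 ++ s2) = block_union s1 :|: block_union s2.
Proof. by elim: s1 => /= [|b s ->]; rewrite ?set0U ?setUA. Qed.

Lemma block_union_pairs b l : block_union (pair_blocks b l) = pair_support l.
Proof.
elim: l => /= [|p l ->]; first by apply/setP=> x; rewrite !inE.
by apply/setP=> x; rewrite !inE orbA.
Qed.

Lemma disjoint_blocks_pairs b l s : uniq (pair_seq l) -> disjoint_blocks s ->
  [disjoint pair_support l & block_union s] -> disjoint_blocks (pair_blocks b l ++ s).
Proof.
elim: l => //= p l IH; rewrite inE negb_or => /and3P[/andP[n12 n1] n2 u] ds dl.
rewrite IH // ?andbT; last first.
  apply: disjointWl dl; apply/subsetP=> x; rewrite !inE => ->; rewrite !orbT //.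
rewrite block_union_cat block_union_pairs disjoints_subset.
apply/subsetP=> x xp; rewrite !inE negb_or; apply/andP; split.
  by move: xp; rewrite !inE => /orP[/eqP->|/eqP->].
apply: contraL dl => xs; rewrite disjoint_sym disjoints_subset.
apply/subsetP=> /(_ x xs); rewrite !inE.
by move: xp; rewrite !inE => /orP[->|->]; rewrite ?orbT.
Qed.

Lemma block_sizes_cat (s1 s2 : seq ({set T} * bool)) :
  block_sizes (s1 ++ s2) = block_sizes s1 ++ block_sizes s2.
Proof. exact: map_cat. Qed.

Lemma pair_block_sizes b l : uniq (pair_seq l) ->
  block_sizes (pair_blocks b l) = nseq (size l) (2%N, b).
Proof.
elim: l => //= p l IH; rewrite inE negb_or => /and3P[/andP[n12 _] _ /IH->].
by rewrite cards2 n12.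
Qed.

Definition pair_count (a b n : nat) : nat :=
  block_count (nseq a (2%N, false) ++ nseq b (2%N, true)) n.

Lemma paired_pair_seq_sub r X lp ls : paired r X lp ls ->
  [/\ uniq (pair_seq lp), uniq (pair_seq ls), [disjoint pair_support lp & pair_support ls] &
      pair_support lp :|: pair_support ls = X].
Proof.
move=> pr; have := paired_uniq pr; rewrite cat_uniq => /and3P[up _ us].
split=> //; last by apply/setP=> x; rewrite !inE (paired_mem pr) mem_cat.
by rewrite disjoints_subset; apply/subsetP=> x; rewrite !inE => /(paired_pair_seq_disjoint pr).
Qed.

Lemma paired_nbases r X lp ls : paired r X lp ls ->
  (nbases r X <= pair_count (size lp) (size ls) (r X))%N.
Proof.
move=> pr; have hr := paired_rank pr; have [up us dps EX] := paired_pair_seq_sub pr.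
pose s := pair_blocks false lp ++ pair_blocks true ls.
have Es : block_union s = X by rewrite block_union_cat !block_union_pairs.
have -> : pair_count (size lp) (size ls) (r X) =
    block_count (block_sizes s) (r (block_union s)).
  by rewrite Es block_sizes_cat !pair_block_sizes.
rewrite -{1}Es; apply: nbases_block_count => //.
  apply: disjoint_blocks_pairs; rewrite ?block_union_pairs //.
  by rewrite -[pair_blocks _ _]cats0 disjoint_blocks_pairs //= disjoints_subset setC0 subsetT.
rewrite Es => b; rewrite mem_cat => /orP[/mapP[p pl ->]|/mapP[p pl ->]] /=.
  by rewrite (paired_parallel pr pl).
have sub := paired_series_sub pr pl.
have [||h _] := series_rank pr pl (subsetDl X (pair_set p)); rewrite ?inE ?eqxx ?orbT //.
rewrite -h; apply: rank_mono => //; rewrite subUset subsetDl andbT sub1set.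
by rewrite (subsetP sub) ?set21.
Qed.

(** Every basis meets the series pair. Those containing a given single element of it correspond to
    bases of the rest, and those containing both to bases of the contraction. *)
Lemma series_nbases r X lp ls p : paired r X lp ls -> p \in ls ->
  nbases r X = (2 * nbases r (X :\: pair_set p) +
                nbases (contract r (pair_set p)) (X :\: pair_set p))%N.
Proof.
move=> pr pl; have hr := paired_rank pr; have lf := paired_loopfree pr.
have cf := paired_coloopfree pr; have [_ us _ _] := paired_pair_seq_sub pr.
have ne := uniq_pair_seq_neq us pl.
have := paired_series_sub pr pl; rewrite subUset !sub1set => /andP[p1 p2].
have p21 : p.2 \in X :\ p.1 by rewrite !inE eq_sym ne.
have EW : X :\ p.1 :\ p.2 = X :\: pair_set p by rewrite setDDl.
have hr1 := contract_is_rank [set p.1] hr.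
have [||h1 h2] := series_rank pr pl (subsetDl X (pair_set p)); rewrite ?inE ?eqxx ?orbT //.
set W := X :\: pair_set p in EW h1 h2 *.
have E1 : p.2 |: W = X :\ p.1 by rewrite -EW setD1K.
have E2 : p.1 |: W = X :\ p.2.
  by apply/setP=> x; rewrite !inE; case: (eqVneq x p.1) => [->|_] //=; rewrite ne p1.
have rX1 := cf _ p1; have rX2 := cf _ p2.
have rpp : r (pair_set p) = 2%N := series_rank2 pr pl.
have rc12 : contract r [set p.1] [set p.2] = 1%N by rewrite /contract setUC rpp lf.
rewrite (nbasesD1 hr p1 (lf _ p1) rX1) (nbases_coloop hr p21) ?EW; last first.
  by rewrite -E1 h2; lia.
rewrite (nbasesD1 hr1 p21 rc12) ?EW; last first.
  have := contractE [set p.1] W hr; have := contractE [set p.1] (X :\ p.1) hr.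
  by rewrite !(setUC _ [set p.1]) setD1K // E2 rX2; lia.
have e1 : nbases (contract r [set p.1]) W = nbases r W.
  by apply: eq_nbases => A; apply: contract_coloop.
have e2 : nbases (contract (contract r [set p.1]) [set p.2]) W = nbases (contract r (pair_set p)) W.
  by apply: eq_nbases => A _; apply: contract_contract.
by rewrite e1 e2; lia.
Qed.

(* Four parallel and four series pairs, two parallel pairs becoming a single parallel
   class of size 4 after contraction of one series pair. *)
Definition merged_count : nat :=
  (2 * pair_count 4 3 7 +
   block_count ((4%N, false) :: nseq 2 (2%N, false) ++ nseq 3 (2%N, true)) 6)%N.

(** Only the bases containing both elements of [p] are counted better than before: in the
    contraction, of rank 6, the pairs [q] and [q'] together have rank 1 and form one parallel block
    of four. *)
Lemma merged_nbases_aux r X p q q' lp ls : paired r X (q :: q' :: lp) (p :: ls) ->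
  size lp = 2%N -> size ls = 3%N -> r X = 8%N ->
  contract r (pair_set p) [set q.1; q'.1] = 1%N -> (nbases r X <= merged_count)%N.
Proof.
move=> pr slp sls rX rxy; have hr := paired_rank pr; have lf := paired_loopfree pr.
have pl : p \in p :: ls := mem_head _ _.
have [up us dps EX] := paired_pair_seq_sub pr.
have sub1 := paired_series_sub pr pl.
have [||h1 _] := series_rank pr pl (subsetDl X (pair_set p)); rewrite ?inE ?eqxx ?orbT //.
have hrc := contract_is_rank (pair_set p) hr.
have rpp := series_rank2 pr pl.
rewrite (series_nbases pr pl); set W := X :\: pair_set p in h1 *.
have uls : uniq (pair_seq ls) by move: us => /= /and3P[].
have ulp : uniq (pair_seq (q' :: lp)) by move: up => /= /and3P[].
have ulp' : uniq (pair_seq lp) by move: ulp => /= /and3P[].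
have npl : pair_set p :&: pair_support ls = set0.
  apply/setP=> x; rewrite in_setI in_set0; apply/negP=> /andP[xp].
  rewrite inE => xl; move: us => /=; rewrite inE negb_or => /and3P[/andP[_ n1] n2 _].
  by move: xp n1 n2; rewrite !inE => /orP[/eqP<-|/eqP<-]; rewrite xl.
have Ep : pair_support (p :: ls) = pair_set p :|: pair_support ls.
  by apply/setP=> x; rewrite !inE orbA.
have dpp : [disjoint pair_support (q :: q' :: lp) & pair_set p].
  by apply: disjointWr dps; rewrite Ep subsetUl.
have dpl : [disjoint pair_support (q :: q' :: lp) & pair_support ls].
  by apply: disjointWr dps; rewrite Ep subsetUr.
have EW : W = pair_support (q :: q' :: lp) :|: pair_support ls.
  rewrite /W -EX Ep setDUl (setDUl (pair_set p) (pair_support ls)) setDv set0U; congr (_ :|: _); apply/setDidPl => //.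
  by rewrite -setI_eq0 setIC npl.
have rW : r W = 7%N.
  have ne := uniq_pair_seq_neq us pl.
  have E : p.1 |: W = X :\ p.2.
    apply/setP=> x; rewrite !inE; case: (eqVneq x p.1) => [->|_] //=.
    by rewrite ne (subsetP sub1) ?set21.
  have := h1; rewrite E (paired_coloopfree pr (subsetP sub1 _ (set22 _ _))) rX; clear; lia.
have serW (h : T * T) : h \in ls -> (r (W :\: pair_set h) < r W)%N.
  move=> hl; have hl' : h \in p :: ls by rewrite inE hl orbT.
  have sWX : W :\: pair_set h \subset X by rewrite setDDl subsetDl.
  have [||h2 _] := series_rank pr hl' sWX; rewrite ?inE ?eqxx ?orbT //.
  rewrite -h2; apply: rank_mono => //; rewrite subUset subsetDl andbT sub1set EW inE.
  by rewrite [_ \in pair_support ls]inE; case: (mem_pair_seq hl) => ->; rewrite orbT.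
rewrite /merged_count; apply: leq_add; first rewrite leq_mul2l.
  pose s := pair_blocks false (q :: q' :: lp) ++ pair_blocks true ls.
  have Es : block_union s = W by rewrite block_union_cat !block_union_pairs.
  have -> : pair_count 4 3 7 = block_count (block_sizes s) (r (block_union s)).
    rewrite Es rW block_sizes_cat !pair_block_sizes // sls.
    by have -> : size (q :: q' :: lp) = 4%N by rewrite /= slp.
  rewrite -{1}Es; apply: nbases_block_count => //.
    apply: disjoint_blocks_pairs; rewrite ?block_union_pairs //.
    by rewrite -[pair_blocks _ _]cats0 disjoint_blocks_pairs //= disjoints_subset setC0 subsetT.
  rewrite Es => b; rewrite mem_cat => /orP[/mapP[h hl ->]|/mapP[h hl ->]] /=.
    by rewrite (paired_parallel pr hl).
  exact: serW.
pose G := pair_set q :|: pair_set q'.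
pose s := (G, false) :: pair_blocks false lp ++ pair_blocks true ls.
have Es : block_union s = W.
  rewrite EW /= block_union_cat !block_union_pairs setUA; congr (_ :|: _).
  by apply/setP=> x; rewrite !inE !orbA.
have disjG : [disjoint G & pair_support lp :|: pair_support ls].
  rewrite -setI_eq0; apply/eqP/setP=> x; rewrite in_setI in_set0; apply/negP=> /andP[xG].
  have xq : x \in pair_support (q :: q' :: lp).
    by move: xG; rewrite !inE -!orbA => /or4P[]->; rewrite ?orbT.
  rewrite in_setU (disjointFr dpl xq) orbF inE => xl.
  move: up => /=; rewrite !inE !negb_or => /and5P[/and4P[_ _ _ n1] /and3P[_ _ n2] /andP[_ n3] n4 _].
  by move: xG n1 n2 n3 n4; rewrite !inE -orbA => /or4P[]/eqP<-; rewrite xl.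
have cG : #|G| = 4%N.
  have n12 := uniq_pair_seq_neq up (mem_head _ _).
  have n12' := uniq_pair_seq_neq ulp (mem_head _ _).
  rewrite cardsU !cards2 n12 n12' /=; have -> : pair_set q :&: pair_set q' = set0.
    apply/setP=> x; rewrite in_setI in_set0; apply/negP=> /andP[xq xq'].
    have E := uniq_pair_seq_pair up (mem_head _ _) _ xq xq'.
    move: up; rewrite E ?inE ?eqxx ?orbT //= !inE eqxx.
    by rewrite !orbT.
  by rewrite cards0.
have rcW : contract r (pair_set p) W = 6%N.
  have := contractE (pair_set p) W hr; rewrite rpp.
  have -> : W :|: pair_set p = X.
    apply/setP=> x; rewrite /W in_setU in_setD.
    by case: (boolP (x \in pair_set p)) => [/(subsetP sub1)->|_]; rewrite ?orbT ?orbF.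
  by rewrite rX; clear; lia.
have -> : block_count ((4%N, false) :: nseq 2 (2%N, false) ++ nseq 3 (2%N, true)) 6 =
    block_count (block_sizes s) (contract r (pair_set p) (block_union s)).
  rewrite Es rcW /s /block_sizes map_cons -/(block_sizes _) block_sizes_cat.
  by rewrite !pair_block_sizes // slp sls cG.
rewrite -{1}Es; apply: nbases_block_count => //.
  apply/andP; split; first by rewrite block_union_cat !block_union_pairs.
  apply: disjoint_blocks_pairs; rewrite ?block_union_pairs //.
    by rewrite -[pair_blocks _ _]cats0 disjoint_blocks_pairs //= disjoints_subset setC0 subsetT.
  by apply: disjointWl dpl; apply/subsetP=> x; rewrite !inE => ->; rewrite !orbT.
rewrite Es => b; rewrite inE mem_cat => /or3P[/eqP->|/mapP[h hl ->]|/mapP[h hl ->]] /=.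
- rewrite -rxy /contract leq_sub2r //.
  have -> : r ([set q.1; q'.1] :|: pair_set p) = r (([set q.1; q'.1] :|: pair_set p) :|: G).
    apply/esym/closureU => // x xG.
    have cl a : a \in q :: q' :: lp -> x \in pair_set a -> r (x |: [set a.1]) = r [set a.1].
      move=> al xa; have suba := paired_pair_sub pr al.
      rewrite (lf _ (subsetP suba _ (set21 _ _))); apply/eqP.
      rewrite eqn_leq -{1}(paired_parallel pr al) rank_mono ?subUset ?sub1set ?xa ?set21 //=.
      by rewrite -(lf _ (subsetP suba _ (set21 a.1 a.2))) rankU1_ge.
    move: xG; rewrite in_setU => /orP[/(cl q (mem_head _ _))|/(cl q')] h.
      by apply: closure_mono h; rewrite // sub1set !inE eqxx.
    by apply: closure_mono (h _); rewrite ?sub1set ?inE ?eqxx ?orbT.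
  by rewrite rank_mono // setUC setSU // subsetUr.
- have := contractE (pair_set p) (pair_set h) hr; have := rankU_le (pair_set h) (pair_set p) hr.
  by rewrite (paired_parallel pr) ?inE ?hl ?orbT //; clear; lia.
have hl' : h \in p :: ls by rewrite inE hl orbT.
have := contractE (pair_set p) (W :\: pair_set h) hr; have := contractE (pair_set p) W hr.
have sX : (W :\: pair_set h) :|: pair_set p \subset X.
  by rewrite subUset sub1 andbT setDDl subsetDl.
have hp a : a \in pair_set h -> a \notin (W :\: pair_set h) :|: pair_set p.
  move=> ah; rewrite in_setU in_setD ah /=; apply/negP=> ap.
  have : a \in pair_set p :&: pair_support ls by rewrite in_setI ap inE (mem_pair_seq_pair hl).
  by rewrite npl inE.
have [h2 _] := series_rank pr hl' sX (hp _ (set21 _ _)) (hp _ (set22 _ _)).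
have : (r (h.1 |: (W :\: pair_set h :|: pair_set p)) <= r (W :|: pair_set p))%N.
  apply: rank_mono => //; rewrite setUA setSU // subUset subsetDl andbT sub1set EW in_setU.
  by rewrite [_ \in pair_support ls]inE; case: (mem_pair_seq hl) => ->; rewrite orbT.
by rewrite h2; clear; lia.
Qed.

End PairedMerinoWelsh.

(** * Numerical cases and the induction on the ground set *)

Section MainInduction.
Variable T : finType.
Implicit Types (A B C D P W X Y Z : {set T}) (e f g h x y : T) (r : {set T} -> nat).
Implicit Types (p q : T * T) (l lp ls : seq (T * T)).

(** Since the series representatives form a circuit of the dual, the three series pairs other than
    [p] still have full dual rank 3. By duality the parallel representatives together with [p] have
    rank 5 = 3 + 2, so contracting [p] does not change their 4-element circuit. *)
Lemma kappa_circuits r X lp ls p : paired r X lp ls -> size lp = 4%N -> size ls = 4%N ->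
  r (firsts lp) = 3%N -> dual r X (firsts ls) = 3%N -> p \in ls ->
  tutte20 (contract r (pair_set p)) (firsts lp) = 14.
Proof.
move=> pr slp sls rP rS pl; have hr := paired_rank pr; have prd := paired_dual pr.
have hd := dual_is_rank X hr.
have [up us dps EX] := paired_pair_seq_sub pr.
have cP : #|firsts lp| = 4%N by rewrite card_firsts.
have cS : #|firsts ls| = 4%N by rewrite card_firsts.
have rpp := series_rank2 pr pl; have sub1 := paired_series_sub pr pl.
have rX : r X = 8%N by move: (paired_rank_eq pr); rewrite rP rS sls; clear; lia.
set D := pair_support ls :\: pair_set p.
have sDX : D \subset X by rewrite -EX (subset_trans (subsetDl _ _)) ?subsetUr.
have rD : dual r X D = 3%N.
  have le3 : (dual r X D <= 3)%N.
    by have := paired_rank_pair_seq prd set0; rewrite !setU0 -rS => <-; rewrite rank_mono ?subsetDl.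
  have c3 : #|firsts ls :\ p.1| = 3%N.
    by move: cS; rewrite (cardsD1 p.1) (_ : p.1 \in firsts ls) => [[]//|]; apply/firstsP; exists p.
  have ge3 : (3 <= dual r X D)%N.
    rewrite -c3 -(paired_simple prd (subsetDl _ [set p.1])) ?c3 //; apply: rank_mono => //.
    apply/subsetP=> x; rewrite !in_setD in_set1 => /andP[xp1 xS].
    rewrite (subsetP (firsts_pair_seq ls)) // andbT.
    case/firstsP: xS xp1 => q ql -> ne; apply: contra ne => /(uniq_pair_seq_pair us ql pl).
    by rewrite set21 => /(_ isT) ->.
  by apply/eqP; rewrite eqn_leq le3.
have cD : #|D| = 6%N.
  have := cardsID (pair_set p) (pair_support ls); rewrite card_pair_seq // sls.
  have -> : pair_support ls :&: pair_set p = pair_set p.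
    by apply/setIidPr/subsetP=> x xp; rewrite inE (mem_pair_seq_pair pl).
  by rewrite cards2 (uniq_pair_seq_neq us pl) -/D; clear; lia.
have ED : X :\: D = pair_support lp :|: pair_set p.
  rewrite /D setDDr (paired_complement pr); congr (_ :|: _); exact/setIidPr.
have rU : r (firsts lp :|: pair_set p) = 5%N.
  have := dualE hr sDX; rewrite rD cD rX ED (paired_rank_pair_seq pr); clear; lia.
rewrite (@eq_tutte20 _ _ r) => [|A sA].
  by apply: tutte20_circuit4 => //; apply: (paired_simple pr).
have := contractE (pair_set p) A hr; have := rankU_mono (pair_set p) hr sA.
have := rankU_le A (pair_set p) hr.
rewrite (setUC (pair_set p) A) (setUC (pair_set p)) rU rP rpp; clear; lia.
Qed.

Lemma kappa_independent r X lp ls p : paired r X lp ls -> size lp = 4%N ->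
  r (firsts lp) = 4%N -> p \in ls ->
  (forall x y, x \in firsts lp -> y \in firsts lp -> x != y ->
     contract r (pair_set p) [set x; y] != 1%N) ->
  12 <= tutte20 (contract r (pair_set p)) (firsts lp).
Proof.
move=> pr slp rP pl h; have hr := paired_rank pr; have [up _ _ _] := paired_pair_seq_sub pr.
apply: tutte20_ge12 => //.
- exact: contract_is_rank.
- by rewrite card_firsts.
- by have := series_contract_rank pr pl; rewrite rP.
- exact: series_contract_loopfree pr _ pl.
Qed.

Lemma merged_nbases r X lp ls p x y : paired r X lp ls -> size lp = 4%N -> size ls = 4%N ->
  r (firsts lp) = 4%N -> dual r X (firsts ls) = 4%N -> p \in ls ->
  x \in firsts lp -> y \in firsts lp -> x != y ->
  contract r (pair_set p) [set x; y] = 1%N -> (nbases r X <= merged_count)%N.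
Proof.
move=> pr slp sls rP rS pl /firstsP[q ql ->] /firstsP[q' ql' ->] ne rxy.
have rX : r X = 8%N by move: (paired_rank_eq pr); rewrite rP rS sls; clear; lia.
have qq' : q' \in rem q lp.
  have : q' \in q :: rem q lp by rewrite -(perm_mem (perm_to_rem ql)).
  by rewrite inE => /predU1P[E|//]; rewrite E eqxx in ne.
have hp := perm_to_rem ql; have hp' := perm_to_rem qq'; have hs := perm_to_rem pl.
have hlp : perm_eq lp (q :: q' :: rem q' (rem q lp)).
  by apply: (perm_trans hp); rewrite perm_cons.
apply: (merged_nbases_aux (paired_perm hlp hs pr)) => //.
- by have := perm_size hlp; rewrite slp => -[].
- by have := perm_size hs; rewrite sls => -[].
Qed.

(* Binary numbers keep the evaluation of the squares below cheap. *)
Definition sq_check (n a b : nat) : bool :=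
  BinNat.N.leb (BinNat.N.mul (BinNat.N.of_nat n) (BinNat.N.of_nat n)) (BinNat.N.mul (BinNat.N.of_nat a) (BinNat.N.of_nat b)).

Definition pair_bound (b t k : nat) : nat := (3 ^ b * t + (3 ^ b - 2 ^ b) * k)%N.

Lemma pair_boundP (b t k : nat) (u v : int) : t%:Z <= u ->
  3 ^+ b * u + (3 ^+ b - 2 ^+ b) * k%:Z <= v -> (pair_bound b t k)%:Z <= v.
Proof.
move=> tu; apply: le_trans.
have le23 : (2 ^ b <= 3 ^ b)%N by case: b => // b; rewrite leq_exp2r.
rewrite /pair_bound -(natz (_ + _)) natrD !natrM (natrB _ le23) !natrX !natz lerD2r.
by rewrite ler_wpM2l // exprn_ge0.
Qed.

Lemma merino_welsh_numeric r X (n a b : nat) : is_rank r -> (nbases r X <= n)%N ->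
  a%:Z <= tutte20 r X -> b%:Z <= tutte02 r X -> sq_check n a b -> merino_welsh r X.
Proof.
move=> hr hn ha hb hc.
have h : (n * n <= a * b)%N by move: hc; rewrite /sq_check => /BinNat.N.leb_le; lia.
rewrite /merino_welsh.
apply: le_trans (_ : (n * n)%:Z <= _); first by rewrite expr2 -PoszM lez_nat leq_mul.
apply: le_trans (_ : (a * b)%:Z <= _); first by rewrite lez_nat.
by rewrite PoszM ler_pM.
Qed.

(** Both sets of representatives are independent here. Four pairs of each kind are left out because
    the generic bound 1816 is below the count 1921. *)
Definition independent_check : bool :=
  all (fun a => all (fun b => ((a == 4) && (b == 4)) ||
    sq_check (pair_count a b (b + a)) (pair_bound b (2 ^ a) (2 ^ a.-1))
             (pair_bound a (2 ^ b) (2 ^ b.-1))) (iota 0 5)) (iota 0 5).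

(** The parallel representatives form a 4-element circuit: rank 3, value 14, and at least [2 ^ 2]
    after contracting a series pair. The series representatives are independent. *)
Definition circuit_check : bool :=
  all (fun b => sq_check (pair_count 4 b (b + 3)) (pair_bound b 14 4)
             (pair_bound 4 (2 ^ b) (2 ^ b.-1))) (iota 0 5).

(** Four pairs of each kind. If a contraction merges two pairs, the count falls to 1745, below 1816.
    If none does on either side, 12 replaces 8 and the bound is 2076 against 1921. If both sets of
    representatives are circuits, it is 2044 against 1921. *)
Definition exceptional_check : bool :=
  [&& sq_check merged_count (pair_bound 4 16 8) (pair_bound 4 16 8),
      sq_check (pair_count 4 4 8) (pair_bound 4 16 12) (pair_bound 4 16 12) &
      sq_check (pair_count 4 4 8) (pair_bound 4 14 14) (pair_bound 4 14 14)].

Lemma independent_checkT : independent_check. Proof. by vm_compute. Qed.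
Lemma circuit_checkT : circuit_check. Proof. by vm_compute. Qed.
Lemma exceptional_checkT : exceptional_check. Proof. by vm_compute. Qed.

Lemma pow2Z n : (2 ^ n)%N%:Z = 2 ^+ n.
Proof. by rewrite -natz natrX. Qed.

Lemma paired_tutte20_bound r X lp ls (t k : nat) : paired r X lp ls ->
  t%:Z <= tutte20 r (firsts lp) ->
  (forall p, p \in ls -> k%:Z <= tutte20 (contract r (pair_set p)) (firsts lp)) ->
  (pair_bound (size ls) t k)%:Z <= tutte20 r X.
Proof. by move=> pr ht hk; apply: pair_boundP ht (paired_lower_bound pr hk). Qed.

Lemma paired_tutte20_generic r X lp ls : paired r X lp ls ->
  (pair_bound (size ls) (2 ^ r (firsts lp)) (2 ^ (r (firsts lp)).-1))%:Z <= tutte20 r X.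
Proof.
move=> pr; apply: (paired_tutte20_bound pr) => [|p pl]; rewrite pow2Z.
  apply: (tutte20_ge_pow2 (paired_rank pr)) => x.
  by move=> /(subsetP (firsts_sub pr)) /(paired_loopfree pr).
exact: (paired_kappa pr).
Qed.

Lemma paired_merino_welsh_44 r X lp ls : paired r X lp ls -> size lp = 4%N -> size ls = 4%N ->
  r (firsts lp) = 4%N -> dual r X (firsts ls) = 4%N -> merino_welsh r X.
Proof.
move=> pr slp sls rP rS; have hr := paired_rank pr; have prd := paired_dual pr.
have nb := paired_nbases pr; have reqn := paired_rank_eq pr.
rewrite slp sls (_ : r X = 8%N) in nb; last by move: reqn; rewrite rP rS sls; clear; lia.
have b20 := paired_tutte20_generic pr; have b02 := paired_tutte20_generic prd.
rewrite sls rP in b20; rewrite slp rS in b02.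
have rP' : dual (dual r X) X (firsts lp) = 4%N by rewrite dual_dual // (firsts_sub pr).
(* [bad] says that contracting one pair of [l'] makes two representatives of [l] parallel. If it
   holds for the matroid or its dual, the merged count applies; otherwise the bound 12 holds on both
   sides. *)
pose bad (r' : {set T} -> nat) l l' := [exists x in firsts l, exists y in firsts l,
  (x != y) && has (fun p => contract r' (pair_set p) [set x; y] == 1%N) l'].
have [/exists_inP[x xP /exists_inP[y yP /andP[xy /hasP[p pl /eqP h]]]]|good] :=
  boolP (bad r lp ls).
  have /and3P[c _ _] := exceptional_checkT.
  exact: (merino_welsh_numeric hr (merged_nbases pr slp sls rP rS pl xP yP xy h) b20 b02 c).
have [/exists_inP[x xP /exists_inP[y yP /andP[xy /hasP[p pl /eqP h]]]]|good'] :=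
  boolP (bad (dual r X) ls lp).
  have := merged_nbases prd sls slp rS rP' pl xP yP xy h.
  rewrite nbases_dual // => nb'; have /and3P[c _ _] := exceptional_checkT.
  exact: (merino_welsh_numeric hr nb' b20 b02 c).
have goodP r' l l' p x y : ~~ bad r' l l' -> p \in l' -> x \in firsts l -> y \in firsts l ->
    x != y -> contract r' (pair_set p) [set x; y] != 1%N.
  move=> /exists_inPn h pl xP yP xy; have /exists_inPn/(_ y yP) := h x xP.
  by rewrite xy /= => /hasPn/(_ p pl).
have h20 : (pair_bound (size ls) 16 12)%:Z <= tutte20 r X.
  apply: (paired_tutte20_bound pr) => [|p pl].
    have -> : 16%N%:Z = 2 ^+ r (firsts lp) by rewrite rP.
    apply: (tutte20_ge_pow2 hr) => x.
    by move=> /(subsetP (firsts_sub pr)) /(paired_loopfree pr).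
  by apply: (kappa_independent pr) => // x y; apply: (goodP _ _ _ _ _ _ good pl).
have h02 : (pair_bound (size lp) 16 12)%:Z <= tutte02 r X.
  apply: (paired_tutte20_bound prd) => [|p pl].
    have -> : 16%N%:Z = 2 ^+ dual r X (firsts ls) by rewrite rS.
    apply: (tutte20_ge_pow2 (dual_is_rank X hr)) => x.
    by move=> /(subsetP (firsts_sub prd)) /(paired_loopfree prd).
  by apply: (kappa_independent prd) => // x y; apply: (goodP _ _ _ _ _ _ good' pl).
rewrite sls in h20; rewrite slp in h02.
have /and3P[_ c _] := exceptional_checkT.
exact: (merino_welsh_numeric hr nb h20 h02 c).
Qed.

Lemma paired_merino_welsh r X lp ls : paired r X lp ls -> merino_welsh r X.
Proof.
(* Up to duality, if only one set of representatives is a circuit, it is that of the parallel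
   pairs. *)
wlog : r lp ls / r (firsts lp) = size lp -> dual r X (firsts ls) = size ls.
  move=> H pr; have hr := paired_rank pr; have prd := paired_dual pr.
  have [up us _ _] := paired_pair_seq_sub pr.
  have := simple_rank (dual_is_rank X hr) _ (paired_simple prd).
  rewrite card_firsts // => /(_ (paired_size prd)) [rS|[sS rS]]; first exact: H pr.
  have [E|ne] := eqVneq (r (firsts lp)) (size lp).
    apply: merino_welsh_dual => //; apply: H prd => E'.
    by rewrite dual_dual // (firsts_sub pr).
  by apply: H pr => E; rewrite E eqxx in ne.
move=> indep pr; have hr := paired_rank pr; have prd := paired_dual pr.
have [up us _ _] := paired_pair_seq_sub pr.
have sp := paired_size pr; have ss := paired_size prd.
have b20 := paired_tutte20_generic pr; have b02 := paired_tutte20_generic prd.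
have reqn := paired_rank_eq pr; have nb := paired_nbases pr.
have := simple_rank hr _ (paired_simple pr); rewrite card_firsts // => /(_ sp) [rP|[slp rP]].
  have rS := indep rP.
  have rX : r X = (size ls + size lp)%N.
    by move: reqn; rewrite rP rS -addnn; clear; lia.
  have /allP/(_ (size lp)) := independent_checkT; rewrite mem_iota => /(_ sp).
  move=> /allP/(_ (size ls)); rewrite mem_iota => /(_ ss) /orP[/andP[/eqP slp /eqP sls]|c].
    by apply: (paired_merino_welsh_44 pr slp sls); rewrite ?rP ?rS.
  rewrite rP in b20; rewrite rS in b02; rewrite rX in nb.
  exact: (merino_welsh_numeric hr nb b20 b02 c).
have t20 : tutte20 r (firsts lp) = 14.
  by apply: tutte20_circuit4; rewrite ?card_firsts //; apply: (paired_simple pr).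
have := simple_rank (dual_is_rank X hr) _ (paired_simple prd).
rewrite card_firsts // => /(_ ss) [rS|[sls rS]].
  have rX : r X = (size ls + 3)%N.
    by move: reqn; rewrite rP rS -addnn; clear; lia.
  have /allP/(_ (size ls)) := circuit_checkT; rewrite mem_iota => /(_ ss) c.
  have h20 : (pair_bound (size ls) 14 4)%:Z <= tutte20 r X.
    apply: (paired_tutte20_bound pr) => [|p /(paired_kappa pr)]; first by rewrite t20.
    by rewrite rP.
  rewrite rX slp in nb; rewrite rS slp in b02.
  exact: (merino_welsh_numeric hr nb h20 b02 c).
have rX : r X = 8%N by move: reqn; rewrite rP rS sls; clear; lia.
have h20 : (pair_bound (size ls) 14 14)%:Z <= tutte20 r X.
  by apply: (paired_tutte20_bound pr) => [|p pl]; rewrite ?t20 // (kappa_circuits pr).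
have h02 : (pair_bound (size lp) 14 14)%:Z <= tutte02 r X.
  apply: (paired_tutte20_bound prd) => [|p pl].
    by rewrite tutte20_circuit4 ?card_firsts //; apply: (paired_simple prd).
  by rewrite (kappa_circuits prd) // dual_dual // (firsts_sub pr).
rewrite rX slp sls in nb; rewrite sls in h20; rewrite slp in h02.
have /and3P[_ _ c] := exceptional_checkT.
exact: (merino_welsh_numeric hr nb h20 h02 c).
Qed.

Lemma pairing_exists Z (R : rel T) : symmetric R ->
  (forall e, e \in Z -> exists2 f, f \in Z & (f != e) && R e f) ->
  (forall e f h, e \in Z -> f \in Z -> h \in Z -> f != e -> h != e -> R e f -> R e h -> f = h) ->
  exists l, [/\ uniq (pair_seq l), pair_support l = Z & forall p, p \in l -> R p.1 p.2].
Proof.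
move=> symR; have [n] := ubnP #|Z|; elim: n Z => // n IH Z ltZ ex un.
have [->|[e eZ]] := set_0Vmem Z.
  by exists [::]; split=> //; apply/setP=> x; rewrite !inE.
have [f fZ /andP[fe Ref]] := ex e eZ.
have fZe : f \in Z :\ e by rewrite !inE fe.
have [|g|a b c|l [ul El hl]] := IH (Z :\ e :\ f).
- by move: ltZ; rewrite (cardsD1 e Z) eZ (cardsD1 f (Z :\ e)) fZe; clear; lia.
- rewrite !inE => /and3P[gf ge gZ]; have [h hZ /andP[hg Rgh]] := ex g gZ.
  exists h; rewrite ?hg // !inE hZ andbT; apply/andP; split.
    apply: contraNneq ge => hf; apply/eqP; apply: (un f) => //.
    - by rewrite eq_sym.
    - by rewrite symR -hf.
    - by rewrite symR.
  apply: contraNneq gf => he; apply/eqP; apply: (un e) => //.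
  by rewrite symR -he.
- by rewrite !inE => /and3P[_ _ aZ] /and3P[_ _ bZ] /and3P[_ _ cZ]; apply: un.
have nl x : x \in pair_seq l = (x \in Z :\ e :\ f) by rewrite -El inE.
exists ((e, f) :: l); split=> /=.
- by rewrite inE negb_or !nl !inE !eqxx /= andbF eq_sym fe.
- apply/setP=> x; rewrite !inE nl !inE.
  by case: (eqVneq x e) => [->|_] //=; case: (eqVneq x f) => [->|].
- by move=> p; rewrite inE => /predU1P[->|/hl].
Qed.

Theorem rank_merino_welsh r X : is_rank r -> loopfree r X -> coloopfree r X ->
  cyclic_width_lt8 r X -> merino_welsh r X.
Proof.
have [n] := ubnP #|X|; elim: n r X => // n IHn r X ltX hr lf cf w.
have IH : merino_welsh_below X.
  by move=> r' Y ltY; apply: IHn; move: ltY ltX; clear; lia.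
apply: contraT => nMW.
have hd := dual_is_rank X hr.
have thr := minimal_thin hr lf cf w IH nMW.
have nd := digon_or hr lf cf w IH nMW.
have thd : thin (dual r X) X.
  apply: minimal_thin => //; first exact: dual_loopfree.
  - exact: dual_coloopfree.
  - exact: width_dual.
  - by apply: contra nMW; apply: merino_welsh_dual.
have thin_unique r' e f h : is_rank r' -> loopfree r' X -> thin r' X ->
    e \in X -> f \in X -> h \in X -> f != e -> h != e ->
    r' [set e; f] = 1%N -> r' [set e; h] = 1%N -> f = h.
  move=> hr' lf' th eX fX hX fe he ref reh; apply/eqP; apply: contraT => fh.
  (* Thinness is used with both outer elements equal to [h]. *)
  have hZ : h \in X :\ e :\ f by rewrite !inE he hX eq_sym fh.
  have ef : e != f by rewrite eq_sym.
  by have := th e f h h eX fX ef ref hZ hZ; rewrite setUid reh lf' // eqxx.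
pose P := [set e in X | [exists f in X, (f != e) && (r [set e; f] == 1%N)]].
have PP e : reflect (e \in X /\ exists f, [/\ f \in X, f != e & r [set e; f] = 1%N]) (e \in P).
  rewrite inE; apply: (iffP andP) => [[eX /exists_inP[f fX /andP[fe /eqP h]]]|[eX [f [fX fe h]]]].
    by split=> //; exists f.
  by split=> //; apply/exists_inP; exists f; rewrite // fe h.
have [|e /PP[eX [f [fX fe ref]]]|e f h /PP[eX _] /PP[fX _] /PP[hX _] fe he /eqP ref /eqP reh|lp [up Ep hp]] :=
    @pairing_exists P (fun e f => r [set e; f] == 1%N).
- by move=> e f; rewrite setUC.
- exists f; last by rewrite fe ref.
  by apply/PP; split=> //; exists e; rewrite eq_sym fe setUC.
- exact: (thin_unique r e).
have ser e : e \in X -> e \notin P ->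
    exists f, [/\ f \in X :\: P, f != e & dual r X [set e; f] = 1%N].
  move=> eX eP.
  have nopar f : f \in X -> f != e -> r [set e; f] != 1%N.
    by move=> fX fe; apply: contra eP => /eqP h; apply/PP; split=> //; exists f.
  (* As [e] has no parallel partner, contracting it creates no loop. If deleting it also created no
     coloop, both minors would satisfy the inequality and so would the whole; a new coloop [f] is a
     series partner. *)
  have [/exists_inP[f fXe rf]|/exists_inPn none] :=
      boolP [exists f in X :\ e, r (X :\ e :\ f) != r (X :\ e)]; last first.
    case/negP: nMW; apply: (merino_welsh_split hr lf cf w IH eX).
      by move=> f /none; rewrite negbK => /eqP.
    move=> f /setD1P[fe fX]; have := nopar f fX fe.
    have := contractE [set e] [set f] hr; rewrite lf // setUC.
    have := rankU1_le e [set f] hr; have := rankU1_ge e [set f] hr; rewrite lf //.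
    clear; lia.
  have /setD1P[fe fX] := fXe; exists f.
  have sef : [set e; f] \subset X by rewrite subUset !sub1set eX.
  have E : X :\ e :\ f = X :\: [set e; f] by rewrite setDDl.
  have cef : #|[set e; f]| = 2%N by rewrite cards2 eq_sym fe.
  split=> //; last first.
    have := dualE hr sef; rewrite cef -E.
    have := rankU1_le f (X :\ e :\ f) hr; have := rankU1_ge f (X :\ e :\ f) hr.
    rewrite setD1K // cf //; move: rf; rewrite cf //; clear; lia.
  (* The series partner has no parallel partner [h]: such an [h] would still span [f] after the
     deletion of [e], so [f] would not be a coloop there. *)
  rewrite inE fX andbT; apply/negP=> /PP[_ [h [hX hf rfh]]].
  have he : h != e.
    by apply/eqP=> eh; have := nopar f fX fe; rewrite setUC -eh rfh.
  case/eqP: rf; rewrite -{2}(setD1K fXe); apply/esym.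
  apply: (@closure_mono _ r f [set h]); rewrite ?sub1set ?inE ?hX ?hf ?he //.
  by rewrite rfh lf.
have [|e|e f h|ls [us Es hs]] := @pairing_exists (X :\: P) (fun e f => dual r X [set e; f] == 1%N).
- by move=> e f; rewrite setUC.
- by rewrite inE => /andP[eP eX]; have [f [fS fe h]] := ser e eX eP; exists f; rewrite // fe h eqxx.
- rewrite !inE => /andP[_ eX] /andP[_ fX] /andP[_ hX] fe he /eqP h1 /eqP h2.
  exact: (thin_unique (dual r X) e f h hd (dual_loopfree hr cf)).
case/negP: nMW; apply: (@paired_merino_welsh _ _ lp ls); split=> //.
- rewrite cat_uniq up us andbT; apply/hasPn=> x xs /=.
  have : x \in pair_support ls by rewrite inE.
  by rewrite Es inE -Ep inE => /andP[].
- move=> x; have -> : (x \in pair_seq lp ++ pair_seq ls) = (x \in pair_support lp) || (x \in pair_support ls).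
    by rewrite !inE mem_cat.
  by rewrite Ep Es in_setD; case: (boolP (x \in P)) => [/PP[]|].
- by move=> p /hp /eqP.
- by move=> p /hs /eqP.
Qed.

End MainInduction.

(** * Rank functions of matroids *)

Section FromMatroid.
Variables (T : finType) (M : matroid T).
Implicit Types (A B C D I J : {set T}) (e f : T).

Lemma indep_rank A I : I \in indep M -> I \subset A -> (#|I| <= rank M A)%N.
Proof. by move=> iI sI; apply: (bigop.bigmax_sup I); rewrite // iI. Qed.

Lemma rank_witness A : exists I, [/\ I \in indep M, I \subset A & #|I| = rank M A].
Proof.
have [|I /andP[iI sI] h] := @bigop.eq_bigmax_cond _ (fun I => (I \in indep M) && (I \subset A))
  (fun I => #|I|).
  by apply/card_gt0P; exists set0; rewrite unfold_in indep0 sub0set.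
by exists I; split; rewrite // -h.
Qed.

Lemma indep_extend A I : I \in indep M -> I \subset A ->
  exists J, [/\ J \in indep M, I \subset J, J \subset A & #|J| = rank M A].
Proof.
have [n] := ubnP (rank M A - #|I|); elim: n I => // n IH I ltI iI sI.
have [eI|neI] := eqVneq #|I| (rank M A); first by exists I.
have [K [iK sK cK]] := rank_witness A.
have lt : (#|I| < #|K|)%N by rewrite cK ltn_neqAle neI indep_rank.
have [e /setDP[eK eI] ieI] := indep_aug iI iK lt.
have [|||J [iJ sJ sJA cJ]] := IH (e |: I) => //.
- by rewrite cardsU1 eI; move: ltI lt; rewrite cK; clear; lia.
- by rewrite subUset sub1set (subsetP sK).
by exists J; split=> //; rewrite (subset_trans _ sJ) ?subsetUr.
Qed.

Lemma matroid_is_rank : is_rank (rank M).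
Proof.
split=> [A|A B sAB|A B].
- by apply/bigop.bigmax_leqP=> I /andP[_ sI]; apply: subset_leq_card.
- apply/bigop.bigmax_leqP=> I /andP[iI sI]; apply: indep_rank => //.
  exact: subset_trans sAB.
have [I [iI sI cI]] := rank_witness (A :&: B).
have [||J [iJ sIJ sJ cJ]] := @indep_extend (A :|: B) I => //.
  by rewrite (subset_trans sI) // subIset // subsetUl.
have hA : (#|J :&: A| <= rank M A)%N.
  by apply: indep_rank; rewrite ?subsetIr // (indepS (subsetIl _ _) iJ).
have hB : (#|J :&: B| <= rank M B)%N.
  by apply: indep_rank; rewrite ?subsetIr // (indepS (subsetIl _ _) iJ).
have := cardsUI (J :&: A) (J :&: B); rewrite -setIUr (setIidPl sJ) setIACA setIid.
have : (#|I| <= #|J :&: (A :&: B)|)%N by rewrite subset_leq_card // subsetI sIJ.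
by move: hA hB; rewrite cI cJ; clear; lia.
Qed.

Let hr := matroid_is_rank.

Lemma tutte_evalE (x y : int) : tutte_eval M x y =
  \sum_(A : {set T}) (x - 1) ^+ (rank M setT - rank M A) * (y - 1) ^+ (#|A| - rank M A).
Proof.
rewrite /tutte_eval /tutte !horner_sum; apply: eq_bigr => A _.
by rewrite !hornerE.
Qed.

Lemma sum_setT (R : nmodType) (F : {set T} -> R) :
  \sum_(A : {set T}) F A = \sum_(A : {set T} | A \subset setT) F A.
Proof. by apply: eq_bigl => A; rewrite subsetT. Qed.

Lemma sign_parity (m n : nat) : odd m = odd n -> (-1 : int) ^+ m = (-1) ^+ n.
Proof. by move=> h; rewrite -(signr_odd _ m) h signr_odd. Qed.

Lemma tutte_eval20 : tutte_eval M 2 0 = tutte20 (rank M) setT.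
Proof.
rewrite tutte_evalE sum_setT; apply: eq_bigr => A _.
rewrite expr1n mul1r sub0r; apply: sign_parity.
by rewrite oddB ?rank_card // oddD.
Qed.

Lemma tutte_eval02 : tutte_eval M 0 2 = tutte02 (rank M) setT.
Proof.
(* Complementation turns the corank of a set into the nullity of its complement in the dual. *)
rewrite tutte_evalE (reindex_inj (inv_inj (@setCK T))) sum_setT /tutte02 /tutte20.
apply: eq_bigr => A sA; rewrite expr1n mulr1 sub0r; apply: sign_parity.
have := dualE hr sA; rewrite setTD => h.
rewrite oddB; last by apply: rank_mono; rewrite ?subsetT.
have : odd (dual (rank M) setT A + rank M setT) = odd (#|A| + rank M (~: A)) by rewrite h.
rewrite !oddD.
by case: (odd #|A|) (odd (rank M _)) (odd (rank M setT)) (odd (dual _ _ _)) => [] [] [] [].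
Qed.

Lemma tutte_eval11 : tutte_eval M 1 1 = (nbases (rank M) setT)%:Z.
Proof.
rewrite tutte_evalE sum_setT /nbases -natz natr_sum; apply: eq_bigr => A sA.
(* Since [0 ^+ 0 = 1], exactly the sets with zero corank and zero nullity contribute, and these are
   the bases. *)
rewrite subrr !expr0n -natrM mulnb; congr (nat_of_bool _)%:R.
have := rank_mono hr sA; have := rank_card A hr; clear; lia.
Qed.

Lemma matroid_loopfree : loopless M -> loopfree (rank M) setT.
Proof.
move=> h e _; have : [set e] \in indep M.
  apply: contraT => ne; case/negP: (h e); apply/minsetP; split=> // B nB.
  by rewrite subset1 => /orP[/eqP//|/eqP B0]; rewrite B0 indep0 in nB.
by move=> /indep_rank/(_ (subxx _)); rewrite cards1; have := rank1_le e hr; clear; lia.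
Qed.

Lemma matroid_coloopfree : coloopless M -> coloopfree (rank M) setT.
Proof.
move=> h e _; have /forallPn[B] := h e; rewrite negb_imply => /andP[/maxsetP[iB mB] eB].
have [J [iJ sBJ _ cJ]] := indep_extend iB (subsetT B).
apply/eqP; rewrite eqn_leq rank_mono ?subsetDl //= -cJ (mB J iJ sBJ).
by apply: indep_rank => //; apply/subsetD1P; rewrite subsetT.
Qed.

Lemma subset_closure A : A \subset Defs.closure M A.
Proof.
apply/subsetP=> x xA; rewrite inE; have -> // : x |: A = A.
by apply/setUidPr; rewrite sub1set.
Qed.

Lemma rank_closure A : rank M (Defs.closure M A) = rank M A.
Proof.
rewrite -(setUidPr (subset_closure A)); apply: closureU => // x.
by rewrite inE => /eqP.
Qed.

(** The closure inherits the absence of coloops. For [e] in it, a maximal independent set avoiding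
    [e] spans it, so adding [e] yields a circuit, and this circuit contains [e]. *)
Lemma closure_cyclic_flat A : coloopfree (rank M) A -> Defs.closure M A \in cyclic_flats M.
Proof.
move=> cA; set G := Defs.closure M A; have sAG : A \subset G := subset_closure A.
have rG : rank M G = rank M A := rank_closure A.
have cG e : e \in G -> rank M (G :\ e) = rank M G.
  move=> eG; apply/eqP; rewrite eqn_leq rank_mono ?subsetDl //= rG.
  have [eA|eA] := boolP (e \in A); last by rewrite rank_mono //; apply/subsetD1P.
  by rewrite -(cA e eA) rank_mono // setSD.
rewrite inE; apply/andP; split.
  rewrite /Defs.flat eqEsubset subset_closure andbT; apply/subsetP=> x; rewrite !inE rG => /eqP h.
  rewrite eqn_leq rankU1_ge // andbT -h rank_mono // setUS //.
apply/existsP; exists [set C | circuit M C & C \subset G]; apply/andP; split.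
  by apply/forall_inP=> C; rewrite inE => /andP[].
rewrite eqEsubset; apply/andP; split; last first.
  by apply/bigcupsP=> C; rewrite inE => /andP[].
apply/subsetP=> e eG; have [I [iI sI cI]] := rank_witness (G :\ e).
have /subsetD1P[sIG eI] := sI.
have dep : e |: I \notin indep M.
  apply/negP=> /indep_rank /(_ (_ : _ \subset G)); rewrite subUset sub1set eG sIG => /(_ isT).
  by rewrite cardsU1 eI cI cG //; clear; lia.
have [C mC sC] := @minset_exists _ (fun C => C \notin indep M) _ dep.
have [nC _] := minsetP mC.
apply/bigcupP; exists C; first by rewrite inE [circuit M C]mC (subset_trans sC) // subUset sub1set eG.
apply: contraR nC => eC; apply: indepS iI.
by apply/subsetP=> x xC; have := subsetP sC x xC; rewrite !inE => /predU1P[xe|//]; rewrite -xe xC in eC.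
Qed.

Lemma matroid_width : CW 7 M -> cyclic_width_lt8 (rank M) setT.
Proof.
move=> w F hF.
have [/existsP[i /existsP[j /andP[ij /eqP h]]]|/existsPn none] :=
  boolP [exists i, exists j, (i != j) && (rank M (F i :|: F j) == rank M (F j))].
  by exists i, j.
(* This gives both that the eight closures are distinct and that they form an antichain. *)
have inc i j : Defs.closure M (F i) \subset Defs.closure M (F j) -> i = j.
  move=> s; apply/eqP; apply: contraT => ij; have /existsPn/(_ j) := none i.
  rewrite ij /=; case/negP; rewrite eqn_leq [X in _ && X]rank_mono ?subsetUr // andbT.
  rewrite -(rank_closure (F j)) rank_mono // subUset subset_closure.
  by rewrite (subset_trans (subset_closure _) s).
have cG : #|[set Defs.closure M (F i) | i : 'I_8]| = 8%N.
  by rewrite card_imset ?card_ord // => i j E; apply: inc; rewrite E.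
suff : (8 <= width (@inclusion T) (cyclic_flats M))%N by move=> lt; move: w; rewrite /CW leqNgt lt.
apply: leq_trans (eq_leq (esym cG)) _; apply: (bigop.bigmax_sup [set Defs.closure M (F i) | i : 'I_8]) => //.
apply/andP; split.
  by apply/subsetP=> _ /imsetP[i _ ->]; apply: closure_cyclic_flat; case: (hF i).
apply/forall_inP=> _ /imsetP[i _ ->]; apply/forall_inP=> _ /imsetP[j _ ->].
by apply/implyP; apply: contra => /inc ->.
Qed.

End FromMatroid.

Theorem theorem2 (T : finType) (M : matroid T)
  (hloop : loopless M) (hcoloop : coloopless M) (hCW : CW 7 M) :
  tutte_eval M 2 0 * tutte_eval M 0 2 >= tutte_eval M 1 1 ^+ 2.
Proof.
rewrite tutte_eval20 tutte_eval02 tutte_eval11; apply: rank_merino_welsh.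
- exact: matroid_is_rank.
- exact: matroid_loopfree.
- exact: matroid_coloopfree.
- exact: matroid_width.
Qed.
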